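(* For concurrent game structures with boolean reward functions the following hold. 1. (Player 1.) Positive winning strategies of player 1 for the objectives $\mathsf{LimInfAvg}(1)$ and $\mathsf{LimInfAvg}(1-\epsilon)$, $\epsilon>0$ (also $\mathsf{LimSupAvg}(1)$ and $\mathsf{LimSupAvg}(1-\epsilon)$, $\epsilon>0$) require infinite memory in general: there are a game and a state in $\mathsf{Positive}_1(\mathsf{LimInfAvg}(1))$ from which, for every $0\le\epsilon<1$, no finite-memory strategy of player 1 is positive winning for $\mathsf{LimInfAvg}(1-\epsilon)$ or for $\mathsf{LimSupAvg}(1-\epsilon)$. In every game, from every state from which player 1 has a positive winning strategy for $\mathsf{LimInfAvg}(1)$, or has for every $\epsilon>0$ a positive winning strategy for $\mathsf{LimInfAvg}(1-\epsilon)$ (respectively the same with $\mathsf{LimSupAvg}$), player 1 has Markov positive winning strategies for these objectives. The optimal bound for the time-dependent memory is $T$ for all $T>0$: Markov strategies have time-dependent memory $T$, and there are a game and a state at which positive winning strategies of player 1 for these objectives exist and every such strategy $\sigma$ (for any of these objectives with $0\le\epsilon<1$) satisfies $\Theta_\sigma(T)\ge T$ for all $T>0$. 2. (Player 2.) In every game, from every state from which player 2 has an almost-sure winning strategy for $\overline{\mathsf{LimInfAvg}}(1)$, or for $\overline{\mathsf{LimInfAvg}}(1-c)$ for some constant $c>0$ (also $\overline{\mathsf{LimSupAvg}}(1)$, or $\overline{\mathsf{LimSupAvg}}(1-c)$ for some $c>0$), player 2 has a stationary almost-sure winning strategy for that kind of objective (for some constant $c>0$ in the latter case). The optimal bound for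 the patience of such stationary almost-sure winning strategies is the size of the action space: such strategies exist with patience at most $m$, and for every $m\ge1$ there is a game with $m$ actions per player and a state from which player 2 has an almost-sure winning strategy for these objectives, but every stationary almost-sure winning strategy of player 2 for them has patience at least $m$.
   Context: A concurrent (two-player stochastic) game structure $G=(S,A,\Gamma_1,\Gamma_2,\delta)$ consists of a finite set $S$ of states, a finite set $A$ of actions, maps $\Gamma_1,\Gamma_2:S\to 2^A\setminus\{\emptyset\}$ ($\Gamma_i(s)$ is the set of actions available to player $i$ at $s$), and a transition function $\delta$ assigning to each $s\in S$, $a_1\in\Gamma_1(s)$, $a_2\in\Gamma_2(s)$ a probability distribution $\delta(s,a_1,a_2)$ on $S$. Notation: $m=\max_{s}\max\{|\Gamma_1(s)|,|\Gamma_2(s)|\}$. In every round both players simultaneously and independently choose available actions, and the successor state is drawn from $\delta$. A play is an infinite sequence $\omega=((s_0,a_1^0,a_2^0),(s_1,a_1^1,a_2^1),\dots)$ of states and action pairs consistent with $\Gamma_1,\Gamma_2$ and the supports of $\delta$. A strategy for player $i$ maps every history $x\cdot s\in(S\times A\times A)^*\times S$ to a probability distribution on $\Gamma_i(s)$. $\Pr_s^{\sigma_1,\sigma_2}$ is the induced probability measure on plays starting in $s$. A boolean reward function is $r:S\times A\times A\to\{0,1\}$. $\mathsf{LimInfAvg}(\omega)=\liminf_{N\to\infty}\frac1N\sum_{i=0}^{N-1}r(s_i,a_1^i,a_2^i)$, and $\mathsf{LimSupAvg}(\omega)$ is the same with $\limsup$. For $\mathsf{L}\in\{\mathsf{LimInfAvg},\mathsf{LimSupAvg}\}$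 and real $\lambda$: $\mathsf{L}(\lambda)=\{\omega\mid\mathsf{L}(\omega)\ge\lambda\}$, $\overline{\mathsf{L}}(\lambda)=\{\omega\mid\mathsf{L}(\omega)<\lambda\}$. A strategy $\sigma_1$ is almost-sure winning (positive winning) for $\Phi$ from $s$ if $\Pr_s^{\sigma_1,\sigma_2}(\Phi)=1$ ($>0$) for all $\sigma_2$; symmetrically for player 2. $\mathsf{Positive}_1(\Phi)$ is the set of states from which player 1 has a positive winning strategy. Strategy classes. Stationary: $\sigma_i(x\cdot s)$ depends only on $s$. The patience of a stationary strategy is the inverse of the smallest non-zero probability it assigns to an action in some state. Markov: $\sigma_i(x\cdot s)$ depends only on $s$ and the length $|x|$. Any strategy can be represented by a set $\mathsf{Mem}$ of memory states with an initial memory state, a deterministic memory-update function $S\times A\times A\times\mathsf{Mem}\to\mathsf{Mem}$ and a next-move function $S\times\mathsf{Mem}\to\mathcal D(A)$, where $\mathcal D(A)$ is the set of probability distributions on $A$; it is finite-memory if $\mathsf{Mem}$ can be chosen finite. For a strategy $\sigma$ so represented, let $t(x)$ be the memory state after history $x$; the time-dependent memory $\Theta_\sigma(T)$ is the number of distinct memory states $t(x)$ used in the first $T$ rounds, i.e. over histories $x\in(S\times A\times A)^*$ with $|x|<T$. Lower bounds on $\Theta_\sigma$ refer to every representation of $\sigma$; a Markov strategy is represented with the round number as memory state. *)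

(* Defs.v *)
From HB Require Import structures.
From mathcomp Require Import all_boot all_order all_algebra.
From mathcomp Require Import finmap all_classical all_reals all_analysis.
From mathcomp Require Import measurable_realfun.

Set Implicit Arguments.
Unset Strict Implicit.
Unset Printing Implicit Defensive.

Import Order.TTheory GRing.Theory Num.Theory.
Import numFieldNormedType.Exports.

Local Open Scope classical_set_scope.
Local Open Scope ring_scope.

Record fdist (R : realType) (T : finType) := FDist {
  fmass :> T -> R;
  fmass_ge0 : forall t, 0 <= fmass t;
  fmass_sum1 : \sum_t fmass t = 1 }.

(* The library requires the carrier of a sigma-algebra to be pointed, so the
   type of infinite sequences carries a default letter t0; it plays no other
   role. *)
Definition iseq (T : finType) (t0 : T) : Type := nat -> T.

HB.instance Definition _ (T : finType) (t0 : T) :=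
  Choice.copy (iseq t0) (nat -> T).
HB.instance Definition _ (T : finType) (t0 : T) :=
  isPointed.Build (iseq t0) (fun=> t0).

Definition cylinder (T : Type) (h : seq T) : set (nat -> T) :=
  [set w | mkseq w (size h) = h].

Definition cylinders (T : finType) (t0 : T) : set (set (iseq t0)) :=
  range (@cylinder T).
Arguments cylinders {T} t0.

Notation iseq_space t0 := (g_sigma_algebraType (cylinders t0)).

(* Random sequences: p h is the law of the next letter given the past h, and
   weight p h is the resulting probability of the initial segment h. *)
Definition weight (R : realType) (T : finType) (t0 : T)
    (p : seq T -> fdist R T) (h : seq T) : R :=
  \prod_(i < size h) p (take i h) (nth t0 h i).

Section law_existence.
Variables (R : realType) (T : finType) (t0 : T) (p : seq T -> fdist R T).
Local Notation W := (weight t0 p).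

Lemma weight_nil : W [::] = 1.
Proof. by rewrite /weight big_ord0. Qed.

Lemma weight_rcons h t : W (rcons h t) = W h * p h t.
Proof.
rewrite /weight size_rcons big_ord_recr/= -cats1 take_size_cat//.
rewrite nth_cat ltnn subnn/=; congr (_ * _).
by apply: eq_bigr => i _; rewrite take_cat nth_cat ltn_ord.
Qed.

Lemma weight_ge0 h : 0 <= W h.
Proof. by apply: prodr_ge0 => i _; exact: fmass_ge0. Qed.

(* The law is the image of the Lebesgue measure on [0, 1[, which is cut into
   nested half-open intervals [lo h, lo h + weight h[. *)
Let below (d : fdist R T) (t : T) : R :=
  \sum_(u <- take (index t (enum T)) (enum T)) d u.

Let lo (h : seq T) : R :=
  \sum_(i < size h) W (take i h) * below (p (take i h)) (nth t0 h i).

Let I (h : seq T) : interval R := `[lo h, lo h + W h[.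

Let lo_rcons h t : lo (rcons h t) = lo h + W h * below (p h) t.
Proof.
rewrite /lo size_rcons big_ord_recr/= -cats1 take_size_cat//.
rewrite nth_cat ltnn subnn/=; congr (_ + _).
by apply: eq_bigr => i _; rewrite take_cat nth_cat ltn_ord.
Qed.

Let cut (d : fdist R T) (x : R) (s : seq T) :
  0 <= x < \sum_(u <- s) d u ->
  exists2 n, (n < size s)%N &
    \sum_(u <- take n s) d u <= x < \sum_(u <- take n s) d u + d (nth t0 s n).
Proof.
elim/last_ind: s => [|s t IH].
  by rewrite big_nil => /andP[/le_lt_trans/[apply]]; rewrite ltxx.
rewrite -cats1 big_cat big_seq1/= => /andP[x0 xt].
have [xs|sx] := ltP x (\sum_(u <- s) d u).
  have [|n ns] := IH; first by rewrite x0.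
  by move=> H; exists n; rewrite ?size_cat ?ltn_addr// take_cat nth_cat ns.
exists (size s); first by rewrite size_cat addn1.
by rewrite take_size_cat// nth_cat ltnn subnn/= sx.
Qed.

Let I_split h x : x \in I h -> exists t, x \in I (rcons h t).
Proof.
rewrite /I in_itv/= => /andP[lx xu].
have W0 : 0 < W h by rewrite -(ltrD2l (lo h)) addr0 (le_lt_trans lx).
have [|n nT /andP[H1 H2]] := @cut (p h) ((x - lo h) / W h) (enum T).
  rewrite divr_ge0 ?subr_ge0 ?(ltW W0)//= ltr_pdivrMr// -/(index_enum T).
  by rewrite big_enum/= fmass_sum1 mul1r ltrBlDl.
exists (nth t0 (enum T) n); rewrite in_itv/= lo_rcons weight_rcons.
rewrite /below index_uniq ?enum_uniq//.
rewrite -addrA -mulrDr -lerBrDl -ltrBlDl mulrC -ler_pdivlMr// H1.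
by rewrite [W h * _]mulrC -ltr_pdivrMr.
Qed.

Let below_mono (d : fdist R T) t t' :
  (index t (enum T) < index t' (enum T))%N -> below d t + d t <= below d t'.
Proof.
move=> tt'; rewrite /below.
have tT : (index t (enum T) < size (enum T))%N by rewrite index_mem mem_enum.
have -> : \sum_(u <- take (index t (enum T)) (enum T)) d u + d t =
          \sum_(u <- take (index t (enum T)).+1 (enum T)) d u.
  by rewrite (take_nth t0)// -cats1 big_cat big_seq1/= nth_index ?mem_enum.
rewrite -(subnKC tt') takeD big_cat/= lerDl.
by apply: sumr_ge0 => i _; exact: fmass_ge0.
Qed.

Let I_sub h t x : x \in I (rcons h t) -> x \in I h.
Proof.
rewrite /I !in_itv/= lo_rcons weight_rcons => /andP[lx xu].
have b0 : 0 <= below (p h) t by apply: sumr_ge0 => i _; exact: fmass_ge0.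
rewrite (le_trans _ lx) ?lerDl ?mulr_ge0 ?weight_ge0//=.
rewrite (lt_le_trans xu)// -addrA lerD2l -mulrDr ler_piMr ?weight_ge0//.
rewrite -(fmass_sum1 (p h)) -big_enum/= /below.
have tT : (index t (enum T) < size (enum T))%N by rewrite index_mem mem_enum.
rewrite -[X in _ <= \sum_(i <- X) _](cat_take_drop (index t (enum T))).
rewrite big_cat/= lerD2l.
rewrite (drop_nth t0)// big_cons nth_index ?mem_enum// lerDl.
by apply: sumr_ge0 => i _; exact: fmass_ge0.
Qed.

Let I_inj_last h t t' x : x \in I (rcons h t) -> x \in I (rcons h t') -> t = t'.
Proof.
wlog tt' : t t' / (index t (enum T) <= index t' (enum T))%N => [wl|].
  move=> H H'; have := leqP (index t (enum T)) (index t' (enum T)).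
  by case=> [/wl|/ltnW/wl]; [exact|move=> /(_ H' H)].
rewrite /I !in_itv/= !lo_rcons !weight_rcons => /andP[_ xu] /andP[lx _].
move: tt'; rewrite leq_eqVlt => /orP[/eqP tt'|/(below_mono (p h)) b].
  by rewrite -(nth_index t0 (mem_enum T t)) tt' nth_index// mem_enum.
have := le_lt_trans lx xu; rewrite -addrA -mulrDr ltrD2l.
by move=> /lt_le_trans-/(_ _ (ler_wpM2l (weight_ge0 h) b)); rewrite ltxx.
Qed.

Let I_inj h h' x : size h = size h' -> x \in I h -> x \in I h' -> h = h'.
Proof.
elim/last_ind: h h' => [|h t IH] h'; first by move=> /esym/size0nil ->.
case/lastP: h' => [|h' t']; first by rewrite size_rcons.
rewrite !size_rcons => -[hh'] xt xt'.
have E := IH _ hh' (I_sub xt) (I_sub xt'); subst h'.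
by rewrite (I_inj_last xt xt').
Qed.

Let addr (u : R) : nat -> seq T :=
  fix g n := if n is n'.+1 then
    rcons (g n') (odflt t0 [pick t | u \in I (rcons (g n') t)]) else [::].

Let size_addr u n : size (addr u n) = n.
Proof. by elim: n => //= n IH; rewrite size_rcons IH. Qed.

Let addr_in u n : 0 <= u < 1 -> u \in I (addr u n).
Proof.
move=> u01; elim: n => [|n IH].
  by rewrite /I /lo/= big_ord0 weight_nil in_itv/= add0r.
rewrite [addr _ _]/=; case: pickP => [t //|no].
by have [t] := I_split IH; rewrite no.
Qed.

Let code (u : R) : iseq t0 := fun n => nth t0 (addr u n.+1) n.

Let mkseq_code u n : mkseq (code u) n = addr u n.
Proof.
apply: (@eq_from_nth _ t0); rewrite size_mkseq ?size_addr// => i ni.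
rewrite nth_mkseq// /code.
elim: n ni => // n IH; rewrite ltnS leq_eqVlt => /orP[/eqP -> //|ni].
by rewrite (IH ni) [in RHS]/= nth_rcons size_addr ni.
Qed.

Let D : set R := `[0, 1[%classic.

Let code_cylinder h : D `&` code @^-1` cylinder h = [set` I h].
Proof.
have D01 u : D u <-> 0 <= u < 1 by rewrite /D/= in_itv.
have ID x : x \in I h -> 0 <= x < 1.
  elim/last_ind: h => [|h t IH]; last by move=> /I_sub.
  by rewrite /I /lo/= big_ord0 weight_nil in_itv/= add0r.
apply/seteqP; split=> [u [/D01 u01]|u uI].
  by rewrite /cylinder/= mkseq_code => <-; exact: addr_in.
have u01 := ID _ uI; split; first exact/D01.
rewrite /cylinder/= mkseq_code.
by apply: (I_inj _ (addr_in _ u01) uI); rewrite size_addr.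
Qed.

Let cylinder_size0 : cylinder [::] = [set: iseq t0].
Proof. by apply/seteqP; split. Qed.

Let DE u : D u <-> 0 <= u < 1.
Proof. by rewrite /D/= in_itv. Qed.

Let mD : measurable (D : set (measurableTypeR R)).
Proof. exact: measurable_itv. Qed.

Let draw (u : measurableTypeR R) : iseq_space t0 :=
  if 0 <= u < 1 then code u else fun=> t0.

Let draw_cylinder h : D `&` draw @^-1` cylinder h = [set` I h].
Proof.
rewrite -code_cylinder; apply/seteqP; split => u [Du]; split => //;
  by move: b; rewrite /preimage/= /draw (DE u).1.
Qed.

Let measurable_draw : measurable_fun setT draw.
Proof.
apply: (@measurability _ _ _ _ setT draw (cylinders t0)) => //.
move=> _ [_ [h _ <-] <-]; rewrite setTI.
rewrite -(setIT (draw @^-1` _)) -(setUv D) setIUr.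
apply: measurableU; first by rewrite setIC draw_cylinder; exact: measurable_itv.
have [h0|h0] := pselect (cylinder h ((fun=> t0) : iseq t0)).
  rewrite [X in measurable X](_ : _ = ~` D); first exact: measurableC.
  apply/seteqP; split => [u []//|u Du]; split => //.
  by rewrite /preimage/= /draw; case: ifPn => // /DE.
rewrite [X in measurable X](_ : _ = set0)//.
apply/seteqP; split => // u [+ Du]; rewrite /preimage/= /draw.
by case: ifPn => // /DE.
Qed.

Let restr : {measure set (measurableTypeR R) -> \bar R} :=
  mrestr (@lebesgue_measure R) mD.

Let law := pushforward restr draw.

Let law_set0 : law set0 = 0%E. Proof. exact: measure0. Qed.

Let law_ge0 A : (0 <= law A)%E. Proof. exact: measure_ge0. Qed.

Let law_sigma_additive : semi_sigma_additive law.
Proof. exact: measure_semi_sigma_additive. Qed.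

HB.instance Definition _ :=
  isMeasure.Build _ _ _ law law_set0 law_ge0 law_sigma_additive.

Let law_cylinder h : law (cylinder h) = (W h)%:E.
Proof.
rewrite /law /pushforward/= /mrestr setIC draw_cylinder lebesgue_measure_itv/=.
rewrite lte_fin ltrDl -EFinB addrAC subrr add0r.
by case: ltP => // W0; congr EFin; apply/eqP; rewrite eq_le W0 weight_ge0.
Qed.

Let law_setT : law setT = 1%E.
Proof. by rewrite -cylinder_size0 law_cylinder weight_nil. Qed.

HB.instance Definition _ := Measure_isProbability.Build _ _ _ law law_setT.

Theorem law_exists : exists P : probability (iseq_space t0) R,
  forall h, P (cylinder h) = (W h)%:E.
Proof. by exists law; exact: law_cylinder. Qed.

End law_existence.

(* The law of the random sequence with conditional letter laws p. *)
Definition law_of (R : realType) (T : finType) (t0 : T)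
    (p : seq T -> fdist R T) : probability (iseq_space t0) R :=
  projT1 (cid (law_exists t0 p)).

Section law_theory.
Variables (R : realType) (T : finType) (t0 : T) (p : seq T -> fdist R T).
Local Notation W := (weight t0 p).

Lemma law_of_cylinder h : law_of t0 p (cylinder h) = (W h)%:E.
Proof. exact: (projT2 (cid (law_exists t0 p))). Qed.

Lemma measurable_cylinder h : measurable (cylinder h : set (iseq_space t0)).
Proof. by apply: sub_sigma_algebra; exists h. Qed.

Lemma cylinderI (h h' : seq T) : (size h <= size h')%N ->
  cylinder h `&` cylinder h' = set0 \/ cylinder h `&` cylinder h' = cylinder h'.
Proof.
move=> hh'; have [E|E] := eqVneq h (take (size h) h'); [right|left].
  apply/seteqP; split => [w []//|w wh']; split => //.
  rewrite /cylinder/= [RHS]E -[in RHS]wh'.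
  by rewrite -map_take take_iota (minn_idPl hh').
apply/seteqP; split => // w [wh wh']; move/eqP: E; apply.
rewrite -[in LHS]wh -[in RHS]wh'.
by rewrite -map_take take_iota (minn_idPl hh').
Qed.

Theorem law_of_unique (P : probability (iseq_space t0) R) :
  (forall h, P (cylinder h) = (W h)%:E) ->
  forall A, measurable A -> P A = law_of t0 p A.
Proof.
move=> PW A mA.
pose G : set (set (iseq_space t0)) := cylinders t0 `|` [set set0].
have sG : <<s cylinders t0>> = <<s G>> :> set (set (iseq_space t0)).
  apply/seteqP; split.
    apply: smallest_sub => [|B GB]; first exact: smallest_sigma_algebra.
    by apply: sub_sigma_algebra; left.
  apply: smallest_sub => [|B [GB|->]]; first exact: smallest_sigma_algebra.
    exact: sub_sigma_algebra.
  exact: (@measurable0 _ (iseq_space t0)).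
apply: (measure_unique G (fun=> setT)) => //.
- move=> B C [[h _ <-]|->]; last by rewrite set0I; right.
  case=> [[h' _ <-]|->]; last by rewrite setI0; right.
  wlog hh' : h h' / (size h <= size h')%N => [wl|].
    have [/wl//|/ltnW/wl] := leqP (size h) (size h').
    by rewrite setIC.
  by have [->|->] := cylinderI hh'; [right|left; exists h'].
- by move=> _; left; exists [::] => //; apply/seteqP; split.
- by rewrite bigcup_const.
- move=> _ [[h _ <-]|->]; last by rewrite !measure0.
  by transitivity (W h)%:E; [exact: PW|exact/esym/law_of_cylinder].
- by move=> _; exact: le_lt_trans (probability_le1 P measurableT) (ltry _).
Qed.

End law_theory.

Inductive player := One | Two.

(* trans s a b is only relevant for available actions a and b. *)
Record game (R : realType) := Game {
  state : finType;
  action : finType;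
  avail : player -> state -> {set action};
  avail_nonempty : forall i s, exists a, a \in avail i s;
  trans : state -> action -> action -> fdist R state }.

Definition max_actions (R : realType) (G : game R) : nat :=
  \max_(s : state G) maxn #|avail One s| #|avail Two s|.

Definition reward (R : realType) (G : game R) : Type :=
  state G -> action G -> action G -> bool.

Definition round (R : realType) (G : game R) : finType :=
  (state G * action G * action G)%type.

Definition play (R : realType) (G : game R) : Type := nat -> round G.

(* A history x . s is given by the sequence x of the past rounds, in
   chronological order, and the current state s. *)
Record strategy (R : realType) (G : game R) (i : player) := Strategy {
  mixed_move :> seq (round G) -> state G -> fdist R (action G);
  mixed_move_avail : forall x s a, a \notin avail i s -> mixed_move x s a = 0 }.

Section play_law.
Variables (R : realType) (G : game R) (s0 : state G).
Variables (sigma1 : strategy G One) (sigma2 : strategy G Two).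

Definition next_state (x : seq (round G)) (s : state G) : R :=
  if x is r :: x' then
    let: (t, a, b) := last r x' in trans t a b s
  else (s == s0)%:R.

Definition round_mass (x : seq (round G)) (r : round G) : R :=
  let: (s, a, b) := r in next_state x s * sigma1 x s a * sigma2 x s b.

Lemma next_state_ge0 x s : 0 <= next_state x s.
Proof.
case: x => [|r x]/=; first exact: ler0n.
by case: last => -[t a] b; exact: fmass_ge0.
Qed.

Lemma next_state_sum1 x : \sum_s next_state x s = 1.
Proof.
case: x => [|r x]/=; last by case: last => -[t a] b; exact: fmass_sum1.
by rewrite (bigD1 s0)//= eqxx big1 ?addr0// => s /negPf ->.
Qed.

Lemma next_state_rcons x t a b s :
  next_state (rcons x (t, a, b)) s = trans t a b s.
Proof. by case: x => [|r x]//=; rewrite last_rcons. Qed.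

Lemma round_mass_ge0 x r : 0 <= round_mass x r.
Proof.
by case: r => -[s a] b; rewrite !mulr_ge0 ?next_state_ge0 ?fmass_ge0.
Qed.

Lemma round_mass_sum1 x : \sum_r round_mass x r = 1.
Proof.
rewrite -(next_state_sum1 x).
rewrite (eq_bigr (fun r => next_state x r.1.1 * sigma1 x r.1.1 r.1.2 *
  sigma2 x r.1.1 r.2)); last by case=> -[].
rewrite -(pair_bigA _ (fun u b =>
  next_state x u.1 * sigma1 x u.1 u.2 * sigma2 x u.1 b))/=.
under eq_bigr => u _ do rewrite -mulr_sumr fmass_sum1 mulr1.
rewrite -(pair_bigA _ (fun s a => next_state x s * sigma1 x s a))/=.
by under eq_bigr => s _ do rewrite -mulr_sumr fmass_sum1 mulr1.
Qed.

Definition round_law (x : seq (round G)) : fdist R (round G) :=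
  FDist (round_mass_ge0 x) (round_mass_sum1 x).

End play_law.

Definition default_round (R : realType) (G : game R) (s : state G) : round G :=
  (s, xchoose (avail_nonempty One s), xchoose (avail_nonempty Two s)).

Notation play_space s := (iseq_space (default_round s)).

Definition Pr (R : realType) (G : game R) (s : state G)
    (sigma1 : strategy G One) (sigma2 : strategy G Two) :
    probability (play_space s) R :=
  law_of (default_round s) (round_law s sigma1 sigma2).

(* All sequences of rounds are admitted as outcomes; those that start at s and
   respect avail and the supports of trans have probability one. *)
Definition consistent (R : realType) (G : game R) (s : state G) (w : play G) :=
  (w 0%N).1.1 = s /\
  forall n, let: (t, a, b) := w n in
    [/\ a \in avail One t, b \in avail Two t & 0 < trans t a b (w n.+1).1.1].

Lemma weight_mkseq (R : realType) (T : finType) (t0 : T)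
    (p : seq T -> fdist R T) (w : nat -> T) n :
  weight t0 p (mkseq w n.+1) = weight t0 p (mkseq w n) * p (mkseq w n) (w n).
Proof. by rewrite mkseqS weight_rcons. Qed.

Lemma Pr_consistent (R : realType) (G : game R) (s : state G)
    (sigma1 : strategy G One) (sigma2 : strategy G Two) :
  {ae Pr s sigma1 sigma2, forall w, consistent s w}.
Proof.
set P := Pr _ _ _.
set W := weight (default_round s) (round_law s sigma1 sigma2).
pose F n : set (play_space s) :=
  if (choice.unpickle n : option (seq (round G))) is Some h then
    if W h == 0 then cylinder h else set0 else set0.
have : P.-negligible (\bigcup_n F n).
  apply: negligible_bigcup => n; rewrite /F.
  case: (choice.unpickle n : option (seq _)) => [h|]; last exact: negligible_set0.
  case: eqP => [W0|_]; last exact: negligible_set0.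
  exists (cylinder h); split => //; first exact: measurable_cylinder.
  by rewrite [LHS]law_of_cylinder -/W W0.
apply: (@negligibleS _ (play_space s) R P) => w.
apply: contra_notP => nF.
have Wn n : W (mkseq w n) != 0.
  apply/eqP => W0; apply: nF; exists (choice.pickle (mkseq w n)) => //.
  by rewrite /F choice.pickleK W0 eqxx /cylinder/= size_mkseq.
have wn n : round_mass s sigma1 sigma2 (mkseq w n) (w n) != 0.
  by have := Wn n.+1; rewrite /W weight_mkseq mulf_eq0 negb_or => /andP[].
split.
  have := wn 0%N; rewrite /round_mass/=; case: (w 0%N) => -[t a] b/=.
  by have [//|ts] := eqVneq t s; rewrite !mul0r eqxx.
move=> n; have := wn n.+1; have := wn n.
rewrite mkseqS /round_mass; case E : (w n) => [[t a] b].
case: (w n.+1) => -[t' a'] b'; rewrite next_state_rcons /=.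
rewrite !mulf_eq0 !negb_or => /andP[/andP[_ Ha] Hb] /andP[/andP[+ _] _].
move=> Ht; split.
- by apply: contraNT Ha => /mixed_move_avail ->.
- by apply: contraNT Hb => /mixed_move_avail ->.
- by rewrite lt_neqAle eq_sym Ht fmass_ge0.
Qed.

Section objectives.
Variables (R : realType) (G : game R) (r : reward G).

Definition avg (w : play G) (N : nat) : R :=
  N%:R^-1 * \sum_(i < N) (let: (s, a, b) := w i in r s a b)%:R.

Definition LimInfAvg (w : play G) : \bar R := limn_einf (fun N => (avg w N)%:E).

Definition LimSupAvg (w : play G) : \bar R := limn_esup (fun N => (avg w N)%:E).

End objectives.

Inductive limavg := LimInf | LimSup.

Definition payoff (L : limavg) (R : realType) (G : game R) (r : reward G) :
    play G -> \bar R :=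
  match L with LimInf => LimInfAvg r | LimSup => LimSupAvg r end.

Definition at_least (L : limavg) (R : realType) (G : game R) (r : reward G)
    (lambda : R) : set (play G) :=
  [set w | (lambda%:E <= payoff L r w)%E].

Definition less_than (L : limavg) (R : realType) (G : game R) (r : reward G)
    (lambda : R) : set (play G) :=
  [set w | (payoff L r w < lambda%:E)%E].

Lemma measurable_letter (R : realType) (T : finType) (t0 : T) (f : T -> R) i :
  measurable_fun setT ((fun w => f (w i)) : iseq_space t0 -> R).
Proof.
move=> _ B mB; rewrite setTI.
pose F n : set (iseq_space t0) :=
  if (choice.unpickle n : option (seq T)) is Some h then
  if (size h == i.+1) && `[< B (f (nth t0 h i)) >] then cylinder h else set0
  else set0.
rewrite [X in measurable X](_ : _ = \bigcup_n F n).
  apply: bigcupT_measurable => n; rewrite /F.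
  case: (choice.unpickle n : option (seq _)) => [h|]//.
  by case: ifPn => // _; exact: measurable_cylinder.
apply/seteqP; split => [w Bw|w [n _]].
  exists (choice.pickle (mkseq w i.+1)) => //.
  rewrite /F choice.pickleK size_mkseq eqxx/= nth_mkseq//; case: asboolP => // _.
  by rewrite /cylinder /mkset size_mkseq.
rewrite /F; case: (choice.unpickle n : option (seq _)) => [h|]//.
case: andP => // -[/eqP hi /asboolP +].
by rewrite /cylinder/= => + wh; rewrite -wh hi nth_mkseq.
Qed.

Lemma measurable_payoff (L : limavg) (R : realType) (G : game R)
    (r : reward G) (s : state G) :
  @measurable_fun _ _ (play_space s) (\bar R) setT (payoff L r).
Proof.
have mavg N :
    @measurable_fun _ _ (play_space s) (\bar R) setT (fun w => (avg r w N)%:E).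
  apply/measurable_EFinP; apply: measurable_funM => //.
  apply: measurable_sum => i.
  exact: (@measurable_letter _ _ _
    (fun u => (let: (s, a, b) := u in r s a b)%:R)).
case: L; last exact: measurable_fun_limn_esup.
rewrite /payoff /LimInfAvg /limn_einf; apply: measurableT_comp => //.
by apply: measurable_fun_limn_esup => n; apply: measurableT_comp.
Qed.

Lemma measurable_at_least (L : limavg) (R : realType) (G : game R)
    (r : reward G) (lambda : R) (s : state G) :
  measurable (at_least L r lambda : set (play_space s)).
Proof.
rewrite -[X in measurable X]setTI.
exact: emeasurable_fun_c_infty (measurable_payoff L r (s := s)) _.
Qed.

Lemma measurable_less_than (L : limavg) (R : realType) (G : game R)
    (r : reward G) (lambda : R) (s : state G) :
  measurable (less_than L r lambda : set (play_space s)).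
Proof.
rewrite -[X in measurable X]setTI.
exact: emeasurable_fun_infty_o (measurable_payoff L r (s := s)) _.
Qed.

Section winning.
Variables (R : realType) (G : game R).

Definition positive_winning1 (sigma1 : strategy G One) (Phi : set (play G))
    (s : state G) : Prop :=
  forall sigma2 : strategy G Two, (0 < Pr s sigma1 sigma2 Phi)%E.

Definition almost_sure_winning2 (sigma2 : strategy G Two) (Phi : set (play G))
    (s : state G) : Prop :=
  forall sigma1 : strategy G One, Pr s sigma1 sigma2 Phi = 1%E.

Definition Positive1 (Phi : set (play G)) : set (state G) :=
  [set s | exists sigma1, positive_winning1 sigma1 Phi s].

End winning.

Section strategy_classes.
Variables (R : realType) (G : game R) (i : player).
Implicit Types sigma : strategy G i.

Definition stationary_strategy sigma : Prop :=
  forall x y s, sigma x s =1 sigma y s.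

Definition markov_strategy sigma : Prop :=
  forall x y s, size x = size y -> sigma x s =1 sigma y s.

(* Used for stationary strategies only, whence the history is irrelevant; the
   value 1 of the empty minimum is neutral as probabilities are at most 1. *)
Definition patience sigma : R :=
  (\big[Num.min/1]_(u : state G * action G | sigma [::] u.1 u.2 != 0)
     sigma [::] u.1 u.2)^-1.

End strategy_classes.

Record memory_rep (R : realType) (G : game R) (Mem : Type) := MemoryRep {
  mem_init : Mem;
  mem_update : state G -> action G -> action G -> Mem -> Mem;
  mem_next : state G -> Mem -> fdist R (action G) }.

Section memory.
Variables (R : realType) (G : game R).

Definition memory_after (Mem : Type) (M : memory_rep G Mem)
    (x : seq (round G)) : Mem :=
  foldl (fun m r => let: (s, a, b) := r in mem_update M s a b m) (mem_init M) x.

Definition represents (Mem : Type) (M : memory_rep G Mem) (i : player)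
    (sigma : strategy G i) : Prop :=
  forall x s, sigma x s =1 mem_next M s (memory_after M x).

Definition finite_memory (i : player) (sigma : strategy G i) : Prop :=
  exists (Mem : finType) (M : memory_rep G Mem), represents M sigma.

(* The time-dependent memory; {classic Mem} is Mem with classical equality. *)
Definition Theta (Mem : Type) (M : memory_rep G Mem) (T : nat) : nat :=
  #|` fset_set ([set memory_after M x | x in [set x | (size x < T)%N]]
                  : set {classic Mem}) |.

Definition clock_rep (next : state G -> nat -> fdist R (action G)) :
    memory_rep G nat :=
  MemoryRep 0%N (fun _ _ _ n => n.+1) next.

End memory.

(* Main.v *)
Require Import Defs.
From mathcomp Require Import all_boot all_order all_algebra.
From mathcomp Require Import finmap all_classical all_reals all_analysis.
From mathcomp Require Import ring lra zify.

Set Implicit Arguments.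
Unset Strict Implicit.
Unset Printing Implicit Defensive.

Import Order.TTheory GRing.Theory Num.Theory.
Import numFieldNormedType.Exports.

Local Open Scope ring_scope.
Local Open Scope classical_set_scope.

(* The states of a game split into two sets.  On Y, player 2 has actions that
   keep the play in Y whatever player 1 does, and mixing them uniformly gives in
   each round a positive chance either of a reward 0 or of a decrease of a rank;
   hence zero rewards have positive frequency, which follows from a
   supermartingale 2^-(number of zeros) * f(state) and Borel-Cantelli.  Off Y,
   player 1 has in each state s an action such that every reply of player 2
   either yields reward 1 without increasing another rank, or lets some action
   of player 1 decrease that rank with positive probability.  Playing this
   action in round n except with probability 2^-(n+2), when he plays uniformly,
   he wins: among the states reachable with positive probability take one of
   least rank; from there player 2 can only use replies of the first kind, and
   with probability at least 1/2 player 1 never deviates any more.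

   For the memory bound, the threat of a gamble must keep player 2 from denying
   rewards, but a gamble is lost in every round with a reward.  If player 2
   denies the reward exactly when there is no risk of a gamble, then the memory
   states along the play without gambles must be distinct: a cycle either
   contains a risk, so that a gamble is lost almost surely, or from some round
   on all rewards are denied.  For the patience, in the
   one-state game with reward 0 exactly when both players choose the same
   action, player 2 must give positive probability to all m actions. *)

(** * Random sequences *)

Section expectation.
Variables (R : realType) (T : finType) (t0 : T) (p : seq T -> fdist R T).
Local Notation W := (weight t0 p).
Local Notation P := (law_of t0 p).

(* The conditional expectation of F at the prefix of length size h + n, given
   that the sequence begins with h. *)
Fixpoint expect (n : nat) (h : seq T) (F : seq T -> R) : R :=
  if n is n'.+1 then \sum_t p h t * expect n' (rcons h t) F else F h.

Lemma cylinder_rcons (h : seq T) :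
  cylinder h = \bigcup_(t in [set` index_enum T]) cylinder (rcons h t).
Proof.
apply/seteqP; split => w.
  move=> wh; exists (w (size h)); first by rewrite /= mem_index_enum.
  by rewrite /cylinder/= size_rcons mkseqS wh.
move=> [t _]; rewrite /cylinder/= size_rcons mkseqS => /rcons_inj[].
by [].
Qed.

Lemma measurable_cylinder_prefix (n : nat) (h : seq T) (Q : pred (seq T)) :
  measurable (cylinder h `&` [set w | Q (mkseq w (size h + n))]
    : set (iseq_space t0)).
Proof.
elim: n h => [|n IH] h.
  rewrite addn0; case Qh : (Q h).
    rewrite (_ : _ `&` _ = cylinder h); first exact: measurable_cylinder.
    apply/seteqP; split => [w []//|w wh]; split => //=.
    by rewrite (_ : mkseq w _ = h).
  rewrite (_ : _ `&` _ = set0) ?measure0//.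
  apply/seteqP; split => // w [wh] /=.
  by rewrite (_ : mkseq w _ = h) ?Qh.
rewrite cylinder_rcons setI_bigcupl; apply: fin_bigcup_measurable => // t _.
by have := IH (rcons h t); rewrite size_rcons addSnnS.
Qed.

Lemma measurable_prefix (n : nat) (Q : pred (seq T)) :
  measurable ([set w | Q (mkseq w n)] : set (iseq_space t0)).
Proof.
have := measurable_cylinder_prefix n [::] Q.
by rewrite [X in X `&` _](_ : _ = setT) ?setTI//; apply/seteqP; split.
Qed.

(** Splitting the cylinder disjointly by its next letter turns the measure into the recursion of
    [expect]. *)
Lemma expect_prefix (n : nat) (h : seq T) (Q : pred (seq T)) :
  P (cylinder h `&` [set w | Q (mkseq w (size h + n))]) =
  (W h * expect n h (fun h => (Q h)%:R))%:E.
Proof.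
elim: n h => [|n IH] h.
  rewrite addn0 /=; case Qh : (Q h).
    rewrite mulr1 (_ : _ `&` _ = cylinder h); first exact: law_of_cylinder.
    apply/seteqP; split => [w []//|w wh]; split => //=.
    by rewrite (_ : mkseq w _ = h).
  rewrite mulr0 (_ : _ `&` _ = set0) ?measure0//.
  apply/seteqP; split => // w [wh] /=.
  by rewrite (_ : mkseq w _ = h) ?Qh.
set B := [set w | _].
rewrite cylinder_rcons setI_bigcupl.
rewrite (@measure_fin_bigcup _ _ (iseq_space t0) P)//; first last.
- by move=> t _; have := measurable_cylinder_prefix n (rcons h t) Q;
    rewrite size_rcons addSnnS.
- move=> t t' _ _ [w [[w1 _] [w2 _]]].
  move: w1 w2; rewrite /cylinder/= !size_rcons => -> /rcons_inj[].
  by [].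
rewrite -fsbig_seq ?index_enum_uniq//= mulr_sumr -sumEFin.
apply: eq_bigr => t _.
by rewrite mulrA -weight_rcons -IH size_rcons addSnnS.
Qed.

Lemma expect_ge0 n h F : (forall h', 0 <= F h') -> 0 <= expect n h F.
Proof.
move=> F0; elim: n h => //= n IH h.
by apply: sumr_ge0 => t _; rewrite mulr_ge0 ?fmass_ge0.
Qed.

Lemma ler_expect n h F F' :
  (forall h', F h' <= F' h') -> expect n h F <= expect n h F'.
Proof.
move=> FF'; elim: n h => //= n IH h.
by apply: ler_sum => t _; rewrite ler_wpM2l ?fmass_ge0.
Qed.

Lemma expectZ n h c F :
  expect n h (fun h' => c * F h') = c * expect n h F.
Proof.
elim: n h => //= n IH h.
by rewrite mulr_sumr; apply: eq_bigr => t _; rewrite IH mulrCA.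
Qed.

(** Letters of probability 0 contribute nothing to the sums, so it is enough that [Inv] survives
    letters of positive probability. *)
Lemma expect_supermartingale (Inv : seq T -> Prop) (rho : R)
    (Phi : seq T -> R) :
  0 <= rho ->
  (forall h t, Inv h -> 0 < p h t -> Inv (rcons h t)) ->
  (forall h, Inv h -> \sum_t p h t * Phi (rcons h t) <= rho * Phi h) ->
  forall n h, Inv h -> expect n h Phi <= rho ^+ n * Phi h.
Proof.
move=> rho0 Inv_rcons Phi_le; elim=> [|n IH] h hI /=; first by rewrite mul1r.
apply: (@le_trans _ _ (\sum_t p h t * (rho ^+ n * Phi (rcons h t)))).
  apply: ler_sum => t _.
  have := fmass_ge0 (p h) t; rewrite le_eqVlt => /predU1P[<-|pt].
    by rewrite !mul0r.
  by rewrite ler_wpM2l ?IH ?(ltW pt)//; apply: Inv_rcons.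
under eq_bigr do rewrite mulrCA.
rewrite -mulr_sumr exprSr -mulrA ler_wpM2l ?exprn_ge0//.
exact: Phi_le.
Qed.

(* The loss of 2^-(k+2) in round k keeps the bound at 1 - 2^-(k+1), since
   (1 - x)^2 >= 1 - 2x. *)
Lemma expect_stay (Q : pred (seq T)) :
  (forall h, Q h ->
    1 - 2^-1 ^+ (size h).+2 <= \sum_(t | Q (rcons h t)) p h t) ->
  forall n h, Q h -> 1 - 2^-1 ^+ (size h).+1 <= expect n h (fun h => (Q h)%:R).
Proof.
move=> stay; elim=> [|n IH] h Qh /=.
  by rewrite Qh gerBl exprn_ge0.
apply: (@le_trans _ _
  (\sum_(t | Q (rcons h t)) p h t * (1 - 2^-1 ^+ (size h).+2))).
  rewrite -mulr_suml.
  have e0 : 0 <= 2^-1 ^+ (size h).+2 :> R by rewrite exprn_ge0.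
  have e1 : 2^-1 ^+ (size h).+2 <= 1 :> R.
    by rewrite exprn_ile1 ?invr_ge0// invf_le1 ?ler1n.
  apply: le_trans (ler_wpM2r _ (stay _ Qh)); last by rewrite subr_ge0.
  have -> : 2^-1 ^+ (size h).+1 = 2 * 2^-1 ^+ (size h).+2 :> R.
    by rewrite [in RHS]exprS mulrA divff ?mul1r ?pnatr_eq0.
  nra.
rewrite [leRHS](bigID (fun t => Q (rcons h t)))/= ler_wpDr//.
  apply: sumr_ge0 => t _.
  by rewrite mulr_ge0 ?fmass_ge0// expect_ge0// => ?; rewrite ler0n.
apply: ler_sum => t Qt; rewrite ler_wpM2l ?fmass_ge0//.
by rewrite -(size_rcons h t); apply: IH.
Qed.

Lemma measurable_stay (Q : pred (seq T)) (n0 : nat) :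
  measurable ([set w | forall n, (n0 <= n)%N -> Q (mkseq w n)]
    : set (iseq_space t0)).
Proof.
rewrite [X in measurable X](_ : _ = \bigcap_(n in [set n | (n0 <= n)%N])
  [set w | Q (mkseq w n)]); last by [].
by apply: bigcap_measurable => [|n _];
  [exists n0 => /=|exact: measurable_prefix].
Qed.

(** By [expect_stay], extending [h0] by n letters with [Q] still true has probability at least half
    of [W h0]. By prefix closure these events decrease in n, and continuity from above passes the
    bound to their intersection. *)
Lemma prob_stay (Q : pred (seq T)) (h0 : seq T) :
  (forall h, Q h ->
    1 - 2^-1 ^+ (size h).+2 <= \sum_(t | Q (rcons h t)) p h t) ->
  (forall h t, (size h0 <= size h)%N -> Q (rcons h t) -> Q h) ->
  Q h0 -> 0 < W h0 ->
  (0 < P [set w | forall n, (size h0 <= n)%N -> Q (mkseq w n)])%E.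
Proof.
move=> stay Qrcons Qh0 W0.
pose F n : set (iseq_space t0) :=
  cylinder h0 `&` [set w | Q (mkseq w (size h0 + n))].
have mF n : measurable (F n).
  apply: measurableI; [exact: measurable_cylinder|exact: measurable_prefix].
have niF : nonincreasing_seq F.
  apply/nonincreasing_seqP => n; apply/subsetPset => w [wh /=].
  by rewrite addnS mkseqS => Qw; split => //=; apply: Qrcons Qw;
    rewrite size_mkseq leq_addr.
have mI : measurable (\bigcap_n F n) by exact: bigcap_measurable.
have PF n : ((W h0 / 2)%:E <= P (F n))%E.
  rewrite /F expect_prefix lee_fin ler_wpM2l ?(ltW W0)//.
  apply: le_trans (expect_stay stay n Qh0).
  rewrite exprS.
  have : 2^-1 ^+ size h0 <= 1 :> R.
    by rewrite exprn_ile1 ?invr_ge0// invf_le1 ?ler1n.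
  lra.
have PFoo : (P (F 0%N) < +oo)%E.
  exact: le_lt_trans (probability_le1 P (mF 0%N)) (ltry _).
have cF := @nonincreasing_cvg_mu _ (iseq_space t0) _ P _ PFoo mF mI niF.
apply: (@lt_le_trans _ _ (P (\bigcap_n F n))).
  apply: (@lt_le_trans _ _ (W h0 / 2)%:E).
    by rewrite lte_fin divr_gt0.
  rewrite -(cvg_lim _ cF)//.
  apply: lime_ge; first by apply/cvg_ex; eexists; exact: cF.
  by apply: nearW => n; exact: PF.
apply: le_measure; rewrite ?inE//; first exact: measurable_stay.
move=> w Fw n hn; have [_ /=] := Fw (n - size h0)%N I.
by rewrite subnKC.
Qed.

(** Permits arguments about single sequences: outside a null set, every letter drawn had positive
    conditional probability. *)
Lemma ae_weight_gt0 : {ae P, forall w, forall n, 0 < W (mkseq w n)}.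
Proof.
have H n : W [::] * expect n [::] (fun h => (W h == 0)%:R) = 0.
  elim: n ([::] : seq T) => [|n IH] h /=.
    by case: eqP => [->|_]; rewrite ?mul0r ?mulr0.
  by rewrite mulr_sumr big1// => t _; rewrite mulrA -weight_rcons IH.
have : P.-negligible (\bigcup_n [set w | W (mkseq w n) == 0]).
  apply: (@negligible_bigcup _ (iseq_space t0)) => n.
  exists [set w | W (mkseq w n) == 0]; split => //.
    exact: (@measurable_prefix n (fun h => W h == 0)).
  have := @expect_prefix n [::] (fun h => W h == 0); rewrite H.
  apply: etrans.
  by congr (P _); apply/seteqP; split => [w //|w []].
apply: (@negligibleS _ (iseq_space t0)) => w /existsNP[n /negP].
by rewrite lt_neqAle weight_ge0 andbT negbK eq_sym => Wn; exists n.
Qed.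

Lemma weight_gt0_step (w : nat -> T) n :
  (forall n, 0 < W (mkseq w n)) -> 0 < p (mkseq w n) (w n).
Proof.
move=> Wpos; have := Wpos n.+1; rewrite weight_mkseq.
by rewrite pmulr_rgt0.
Qed.

End expectation.

(** * Limits of averages *)

Section limits.
Variable R : realType.
Implicit Types (u : nat -> \bar R) (c : \bar R).

Lemma limn_esup_le_near u c n0 :
  (forall n, (n0 <= n)%N -> (u n <= c)%E) -> (limn_esup u <= c)%E.
Proof.
move=> uc; rewrite limn_esup_lim; apply: lime_le; first exact: is_cvg_esups.
exists n0 => // n /= hn; apply: ub_ereal_sup => _ [m /= nm <-].
by apply: uc; rewrite (leq_trans hn).
Qed.

Lemma limn_einf_ge_near u c n0 :
  (forall n, (n0 <= n)%N -> (c <= u n)%E) -> (c <= limn_einf u)%E.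
Proof.
move=> uc; rewrite limn_einf_lim; apply: lime_ge; first exact: is_cvg_einfs.
exists n0 => // n /= hn; apply: le_ereal_inf_tmp => _ [m /= nm <-].
by apply: uc; rewrite (leq_trans hn).
Qed.

End limits.

Section payoff.
Variables (R : realType) (G : game R) (r : reward G).
Implicit Types (w : play G) (L : limavg).

Definition round_reward (x : round G) : bool := let: (s, a, b) := x in r s a b.

Definition losses (h : seq (round G)) : nat := count (predC round_reward) h.

Lemma losses_rcons h x : losses (rcons h x) = (losses h + ~~ round_reward x)%N.
Proof. by rewrite /losses -cats1 count_cat/= addn0. Qed.

Lemma avg_losses w N : (0 < N)%N ->
  avg r w N = 1 - (losses (mkseq w N))%:R / N%:R.
Proof.
move=> N0; have NN0 : N%:R != 0 :> R by rewrite pnatr_eq0 -lt0n.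
apply: (mulfI NN0); rewrite /avg mulVKf// mulrBr mulr1 mulrCA divff// mulr1.
clear N0 NN0.
elim: N => [|N IH]; first by rewrite big_ord0 subrr.
rewrite big_ord_recr mkseqS losses_rcons natrD/= IH -addn1 natrD.
rewrite /round_reward; case: (w N) => -[s a] b; case: (r s a b) => /=; lra.
Qed.

Lemma payoff_ge L w (c : R) n0 :
  (forall n, (n0 <= n)%N -> c <= avg r w n) -> (c%:E <= payoff L r w)%E.
Proof.
move=> wc; have H : (c%:E <= LimInfAvg r w)%E.
  by apply: (@limn_einf_ge_near _ _ _ n0) => n hn; rewrite lee_fin wc.
by case: L => //=; apply: (le_trans H); exact: limn_einf_sup.
Qed.

Lemma payoff_le L w (c : R) n0 :
  (forall n, (n0 <= n)%N -> avg r w n <= c) -> (payoff L r w <= c%:E)%E.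
Proof.
move=> wc; have H : (LimSupAvg r w <= c%:E)%E.
  by apply: (@limn_esup_le_near _ _ _ n0) => n hn; rewrite lee_fin wc.
by case: L => //=; apply: (le_trans _ H); exact: limn_einf_sup.
Qed.

Let losses_shift w k m : losses (mkseq w (m + k)) =
  (losses (mkseq w m) + losses (mkseq (fun i => w (m + i)%N) k))%N.
Proof.
rewrite /mkseq iotaD map_cat /losses count_cat; congr (_ + count _ _)%N.
by rewrite add0n -[in LHS](addn0 m) iotaDl -map_comp.
Qed.

Lemma payoff_ge1 L w n0 :
  (forall n, (n0 <= n)%N -> round_reward (w n)) -> (1 <= payoff L r w)%E.
Proof.
move=> w1; apply/lee_addgt0Pr => e e0.
rewrite -leeBlDr// -EFinB.
(* At lengths n >= [N] the at most [n0] losses lower the average by at most [e]. *)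
pose N := (Num.truncn (n0%:R / e)).+1.
apply: (@payoff_ge _ _ _ (n0 + N)) => n hn.
have n0' : (0 < n)%N by rewrite (leq_trans _ hn)// addnS.
rewrite avg_losses// lerB//.
have le_n0 : (losses (mkseq w n) <= n0)%N.
  rewrite -(@subnKC n0 n) ?(leq_trans (leq_addr _ _) hn)// losses_shift.
  rewrite [X in (_ + X)%N](_ : _ = 0%N).
    by rewrite addn0 (leq_trans (count_size _ _))// size_mkseq.
  apply/eqP; rewrite /losses -leqn0 leqNgt -has_count -all_predC.
  by apply/allP => _ /mapP[i _ ->] /=; rewrite negbK w1// leq_addr.
rewrite ler_pdivrMr ?ltr0n// (@le_trans _ _ n0%:R) ?ler_nat//.
rewrite mulrC -ler_pdivrMr// (le_trans (ltW (Num.Theory.truncnS_gt _)))//.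
by rewrite ler_nat (leq_trans _ hn)// leq_addl.
Qed.

Lemma payoff_le0 L w n0 :
  (forall n, (n0 <= n)%N -> ~~ round_reward (w n)) -> (payoff L r w <= 0)%E.
Proof.
move=> w0; apply/lee_addgt0Pr => e e0; rewrite add0e.
pose N := (Num.truncn (n0%:R / e)).+1.
apply: (@payoff_le _ _ _ (n0 + N)) => n hn.
have n0' : (0 < n)%N by rewrite (leq_trans _ hn)// addnS.
rewrite avg_losses// lerBlDl.
have le_n0 : (n - n0 <= losses (mkseq w n))%N.
  rewrite -{2}(@subnKC n0 n) ?(leq_trans (leq_addr _ _) hn)// losses_shift.
  rewrite (leq_trans _ (leq_addl _ _))// /losses.
  rewrite -[leqLHS](size_mkseq (fun i => w (n0 + i)%N)).
  have : all (predC round_reward) (mkseq (fun i => w (n0 + i)%N) (n - n0)).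
    by apply/allP => _ /mapP[i _ ->] /=; rewrite w0// leq_addr.
  by rewrite all_count => /eqP ->; rewrite size_mkseq.
have : (n%:R - n0%:R <= (losses (mkseq w n))%:R :> R).
  by rewrite -natrB ?ler_nat// (leq_trans (leq_addr _ _) hn).
have : n0%:R <= e * n%:R.
  rewrite mulrC -ler_pdivrMr// (le_trans (ltW (Num.Theory.truncnS_gt _)))//.
  by rewrite ler_nat (leq_trans _ hn)// leq_addl.
move=> h1 h2; rewrite -lerBlDr ler_pdivlMr ?ltr0n//; nra.
Qed.

(** The strict inequality pays for remainders: if k is the quotient of n by [d], at least k + 1
    losses occur in fewer than [d] times k + 1 rounds, a fraction above 1/d. *)
Lemma payoff_le_losses L w (d k0 : nat) : (0 < d)%N ->
  (forall k, (k0 <= k)%N -> (k < losses (mkseq w (d * k)))%N) ->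
  (payoff L r w <= (1 - d%:R^-1)%:E)%E.
Proof.
move=> d0 H; apply: (@payoff_le _ _ _ (maxn 1 (d * k0))) => n.
rewrite geq_max => /andP[n0 hn].
have kn : (k0 <= n %/ d)%N by rewrite leq_divRL// mulnC.
rewrite avg_losses// lerB// ler_pdivlMr ?ltr0n// mulrC ler_pdivrMr ?ltr0n//.
rewrite -natrM ler_nat.
have nE : n = (d * (n %/ d) + n %% d)%N by rewrite mulnC -divn_eq.
have le_losses : (losses (mkseq w (d * (n %/ d))) <= losses (mkseq w n))%N.
  by rewrite [in leqRHS]nE losses_shift leq_addr.
have m_lt : (n %% d < d)%N by rewrite ltn_mod.
have := leq_trans (H _ kn) le_losses.
move: (n %/ d)%N (n %% d)%N (losses _) nE m_lt => q m l ->; nia.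
Qed.

End payoff.

Lemma round_lawE (R : realType) (G : game R) (s0 : state G)
    (sigma1 : strategy G One) (sigma2 : strategy G Two) h s a b :
  round_law s0 sigma1 sigma2 h (s, a, b) =
  next_state s0 h s * sigma1 h s a * sigma2 h s b.
Proof. by []. Qed.

(** * The attractor dichotomy *)

Section dichotomy.
Variables (R : realType) (G : game R) (r : reward G).
Implicit Types (s t : state G) (a b : action G) (X Y : {set state G}).

Definition safe_actions Y s : {set action G} :=
  [set b in avail Two s | [forall a in avail One s,
    [forall t, (0 < trans s a b t) ==> (t \in Y)]]].

Lemma safe_actionsP Y s b : reflect
  (b \in avail Two s /\
   forall a t, a \in avail One s -> 0 < trans s a b t -> t \in Y)
  (b \in safe_actions Y s).
Proof.
rewrite inE; apply: (iffP andP) => -[bs H]; split => //.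
  by move=> a t sa; move/forall_inP/(_ a sa)/forallP/(_ t)/implyP: H.
by apply/forall_inP => a sa; apply/forallP => t; apply/implyP; exact: H.
Qed.

(** Safety refers to [Y] but progress to [X], so that [X] can grow inside a fixed [Y]. The reply [b]
    may depend on [a], since uniform mixing hits it with positive probability. *)
Definition attracted Y X (rk : state G -> nat) s : Prop :=
  forall a, a \in avail One s -> exists2 b, b \in safe_actions Y s &
    ~~ r s a b \/ exists t, [/\ t \in X, 0 < trans s a b t & (rk t < rk s)%N].

(** The action [a] is the main one. The deviation [a'] may depend on the reply [b], since a uniform
    choice hits it with positive probability. *)
Definition escaping Y (rk : state G -> nat) s : Prop :=
  exists2 a, a \in avail One s & forall b, b \in avail Two s ->
    (r s a b /\ forall t, 0 < trans s a b t -> t \notin Y /\ (rk t <= rk s)%N)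
    \/ exists a' t, [/\ a' \in avail One s, 0 < trans s a' b t,
         t \notin Y & (rk t < rk s)%N].

Let rank_bound (rk : state G -> nat) : exists k, forall s, (rk s < k)%N.
Proof.
by exists (\max_s rk s).+1 => s; rewrite ltnS (leq_bigmax (F := rk)).
Qed.

Lemma attractor_dichotomy : exists Y (rk rk' : state G -> nat),
  (forall s, s \in Y -> attracted Y Y rk s) /\
  (forall s, s \notin Y -> escaping Y rk' s).
Proof.
pose PY Y := `[< exists rk, forall s, s \notin Y -> escaping Y rk s >].
have PT : PY [set: state G]%SET.
  by apply/asboolP; exists (fun=> 0%N) => s; rewrite inE.
(* Y is least with an escaping complement, X is greatest among the attracted
   subsets of Y; if X were smaller than Y, its complement would be escaping. *)
case: (@arg_minnP _ _ PY (fun Y => #|Y|) PT) => Y /asboolP[rk' esc] Ymin.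
pose PX X := `[< X \subset Y /\
  exists rk, forall s, s \in X -> attracted Y X rk s >].
have P0 : PX finset.set0.
  apply/asboolP; split; first exact: finset.sub0set.
  by exists (fun=> 0%N) => s; rewrite inE.
case: (@arg_maxnP _ _ PX (fun X => #|X|) P0) => X /asboolP[XY [rk att]] Xmax.
have [XeqY|XneY] := eqVneq X Y.
  by subst X; exists Y, rk, rk'; split.
have XpY : (#|X| < #|Y|)%N.
  by rewrite fintype.proper_card// finset.properEneq XneY XY.
suff PYX : PY X by have := Ymin _ PYX; rewrite leqNgt XpY.
have [k rk'k] := rank_bound rk'.
(* States removed from [Y] get a new top rank, above all ranks [rk']. *)
apply/asboolP; exists (fun s => if s \in Y then k else rk' s) => s sX.
have [sY|sY] := boolP (s \in Y); last first.
  have [a sa ab] := esc _ sY; exists a => // b sb; rewrite (negPf sY).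
  have notX t : t \notin Y -> t \notin X by apply: contra => /(fintype.subsetP XY).
  have [[rs H]|[a' [t [sa' tt tY rkt]]]] := ab _ sb; [left|right].
    by split => // t /H[tY rkt]; rewrite (negPf tY); split => //; apply: notX.
  by exists a', t; rewrite (negPf tY); split => //; exact: notX.
(* Otherwise [s] could join [X] with a rank above all those of [rk], against maximality. *)
have : ~ (forall a, a \in avail One s -> exists2 b, b \in safe_actions Y s &
    ~~ r s a b \/ exists t, t \in X /\ 0 < trans s a b t).
  move=> H; have [l rkl] := rank_bound rk.
  have : PX (s |: X)%SET.
    apply/asboolP; split; first by rewrite finset.subUset finset.sub1set sY XY.
    exists (fun t => if t == s then l else rk t) => t /finset.setU1P[->|tX] a ta.
      have [b bs rb] := H a ta; exists b => //.
      case: rb => [|[t' [t'X tt']]]; first by left.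
      right; exists t'; rewrite eqxx !inE t'X orbT; split => //.
      by case: eqP t'X sX => [->->|].
    have ts x : x \in X -> x == s = false.
      by move=> xX; apply: contraNF sX => /eqP <-.
    have [b bs rb] := att t tX a ta; exists b => //.
    case: rb => [|[t' [t'X tt' rkt']]]; first by left.
    by right; exists t'; rewrite !ts// !inE t'X orbT; split.
  by move=> /Xmax; rewrite finset.cardsU1 sX; lia.
(* Against this [a], a safe reply gives reward 1 and stays in [Y] without entering [X]; an unsafe
   reply lets some action leave [Y], where ranks are below [k]. *)
move=> /existsNP[a /not_implyP[sa H]]; exists a => // b sb.
have [bs|nbs] := boolP (b \in safe_actions Y s); [left|right].
  split; first by apply: contrapT => /negP rb; apply: H; exists b => //; left.
  move=> t tt; have [_ /(_ a t sa tt) tY] := safe_actionsP _ _ _ bs.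
  by rewrite tY sY; split => //; apply/negP => tX; apply: H; exists b => //;
    right; exists t.
move: nbs; rewrite inE sb/= => /forall_inPn[a' sa' /forallPn[t]].
rewrite negb_imply => /andP[tt tY]; exists a', t; rewrite sY (negPf tY).
by split => //; apply: contra tY => /(fintype.subsetP XY).
Qed.

End dichotomy.

(** * Player 2: uniform safe strategies *)

Section distributions.
Variables (R : realType) (T : finType).
Implicit Types (A : {set T}) (d : fdist R T).

Lemma uniform_ge0 A t : 0 <= (t \in A)%:R / #|A|%:R :> R.
Proof. by rewrite divr_ge0. Qed.

Lemma uniform_sum1 A : (exists a, a \in A) ->
  \sum_t (t \in A)%:R / #|A|%:R = 1 :> R.
Proof.
move=> [a Aa]; have -> : \sum_t (t \in A)%:R / #|A|%:R = #|A|%:R / #|A|%:R :> R.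
  rewrite -mulr_suml -natr_sum; congr (_%:R / _).
  rewrite -sum1_card [RHS]big_mkcond/=.
  by apply: eq_bigr => t _; case: (t \in A).
by rewrite divff// pnatr_eq0 -lt0n; apply/card_gt0P; exists a.
Qed.

Definition uniform A (A0 : exists a, a \in A) : fdist R T :=
  FDist (uniform_ge0 A) (uniform_sum1 A0).

Lemma exists_set1 (t : T) : exists a, a \in [set t]%SET.
Proof. by exists t; rewrite finset.set11. Qed.

Definition point_mass t : fdist R T := uniform (exists_set1 t).

Lemma point_massE t t' : point_mass t t' = (t' == t)%:R.
Proof. by rewrite /= finset.cards1 divr1 finset.in_set1. Qed.

Lemma mixture_ge0 (e : R) d d' t : 0 <= e <= 1 ->
  0 <= (1 - e) * d t + e * d' t.
Proof.
move=> /andP[e0 e1]; have := fmass_ge0 d t; have := fmass_ge0 d' t; nra.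
Qed.

Lemma mixture_sum1 (e : R) d d' : \sum_t ((1 - e) * d t + e * d' t) = 1.
Proof. by rewrite big_split/= -!mulr_sumr !fmass_sum1 !mulr1 subrK. Qed.

Definition mixture (e : R) (e01 : 0 <= e <= 1) d d' : fdist R T :=
  FDist (fun t => mixture_ge0 d d' t e01) (mixture_sum1 e d d').

Lemma fdist_supp d : exists t, 0 < d t.
Proof.
apply: contrapT => /forallNP d0; have := fmass_sum1 d.
rewrite big1 => [/eqP|t _]; first by rewrite eq_sym oner_eq0.
by apply/eqP; rewrite eq_le fmass_ge0 andbT leNgt; apply/negP/d0.
Qed.

Lemma fdist_le1 d t : d t <= 1.
Proof.
rewrite -(fmass_sum1 d) (bigD1 t)//= lerDl.
by apply: sumr_ge0 => *; exact: fmass_ge0.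
Qed.

(** The gap between [c] and the mean is the mean of the nonnegative shortfalls [c - F t], of which a
    single term is kept. *)
Lemma fdist_sum_le d (F : T -> R) c t0 : (forall t, F t <= c) ->
  \sum_t d t * F t <= c - d t0 * (c - F t0).
Proof.
move=> Fc; rewrite lerBrDl -lerBrDr.
have -> : c - \sum_t d t * F t = \sum_t d t * (c - F t).
  under [RHS]eq_bigr do rewrite mulrBr.
  by rewrite sumrB -mulr_suml fmass_sum1 mul1r.
rewrite (bigD1 t0)//= lerDl; apply: sumr_ge0 => t _.
by rewrite mulr_ge0 ?fmass_ge0// subr_ge0.
Qed.

Lemma fin_pos_lbound (F : T -> R) :
  exists2 e, 0 < e <= 1 & forall t, 0 < F t -> e <= F t.
Proof.
exists (\big[Num.min/1]_(t | 0 < F t) F t) => [|t Ft].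
  rewrite bigmin_le_id andbT; elim/big_ind: _ => // x y x0 y0.
  by rewrite lt_min x0.
exact: bigmin_le_cond.
Qed.

End distributions.

Section uniform_strategy.
Variables (R : realType) (G : game R) (i : player).
Variables (B : state G -> {set action G}).
Hypothesis B0 : forall s, exists a, a \in B s.
Hypothesis B_avail : forall s, B s \subset avail i s.

Definition uniform_strategy : strategy G i.
Proof.
refine (@Strategy R G i (fun _ s => uniform R (B0 s)) _) => x s a sa /=.
by rewrite (negPf (contra (fintype.subsetP (B_avail s) a) sa)) mul0r.
Defined.

Lemma uniform_strategy_stationary : stationary_strategy uniform_strategy.
Proof. by []. Qed.

Lemma uniform_strategy_gt0 x s b : b \in B s -> 0 < uniform_strategy x s b.
Proof.
move=> Bb /=; rewrite Bb divr_gt0// ltr0n; apply/card_gt0P; by exists b.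
Qed.

Lemma card_avail_max (s : state G) : (#|avail i s| <= max_actions G)%N.
Proof.
apply: (@leq_trans (maxn #|avail One s| #|avail Two s|)).
  by case: i; rewrite leq_max leqnn ?orbT.
exact: (leq_bigmax (F := fun s : state G => maxn #|avail One s| #|avail Two s|)).
Qed.

Lemma patience_uniform (s0 : state G) :
  patience uniform_strategy <= (max_actions G)%:R.
Proof.
(* The state [s0] makes the maximum positive; over an empty set of states it would be 0. *)
have m0 : (0 < max_actions G)%N.
  apply: leq_trans (card_avail_max s0); apply/card_gt0P.
  exact: avail_nonempty.
rewrite /patience -[leRHS]invrK lef_pV2 ?posrE; last 2 first.
- elim/big_ind: _ => // [x y x0 y0|u u0]; first by rewrite lt_min x0.
  by rewrite lt_neqAle eq_sym u0 fmass_ge0.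
- by rewrite invr_gt0 ltr0n.
apply/bigmin_geP; split; first by rewrite invf_le1 ?ltr0n// ler1n.
move=> [s a] /= sa.
have Ba : a \in B s by apply: contraNT sa => /negPf ->; rewrite mul0r.
rewrite Ba mul1r lef_pV2 ?posrE ?ltr0n//; last by apply/card_gt0P; exists a.
by rewrite ler_nat (leq_trans (subset_leq_card (B_avail s)))// card_avail_max.
Qed.

End uniform_strategy.

(** * Almost-sure events and Borel-Cantelli *)

Section almost_sure.
Variables (R : realType) (T : finType) (t0 : T) (p : seq T -> fdist R T).
Local Notation P := (law_of t0 p).

Lemma prob1_ae (A : set (iseq_space t0)) : measurable A ->
  {ae P, forall w, A w} -> P A = 1%E.
Proof.
move=> mA [N [mN N0 AN]].
have PC : P (~` A) = 0%E.
  by apply: (subset_measure0 _ mN _ N0) => //; exact: measurableC.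
by have := probability_setC P (measurableC mA); rewrite setCK PC sube0.
Qed.

Lemma prob0_positive_weight (A N : set (iseq_space t0)) :
  measurable A -> measurable N -> P N = 0%E ->
  (forall w, (forall n, 0 < weight t0 p (mkseq w n)) -> A w -> N w) ->
  P A = 0%E.
Proof.
move=> mA mN N0 AN; have [M [mM M0 WM]] := ae_weight_gt0 t0 p.
apply: (subset_measure0 mA (measurableU _ _ mN mM)); last exact: null_set_setU.
move=> w Aw; have [Wpos|Wpos] := pselect (forall n, 0 < weight t0 p (mkseq w n)).
  by left; exact: AN.
by right; exact: WM.
Qed.

(** The first Borel-Cantelli lemma, with summability from a geometric series. *)
Lemma ae_eventually_not (F : nat -> set (iseq_space t0)) (C : R) :
  (forall k, measurable (F k)) ->
  (forall k, P (F k) <= (C * 2^-1 ^+ k)%:E)%E ->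
  {ae P, forall w, exists k0, forall k, (k0 <= k)%N -> ~ F k w}.
Proof.
move=> mF FC.
have C0 : 0 <= C.
  by have := le_trans (measure_ge0 P _) (FC 0%N); rewrite lee_fin expr0 mulr1.
have Foo : (\sum_(n <oo) P (F n) < +oo)%E.
  apply: (@le_lt_trans _ _ (C / (1 - 2^-1))%:E); last exact: ltry.
  apply: lime_le; first exact: is_cvg_nneseries.
  apply: nearW => n.
  apply: (@le_trans _ _ (\sum_(0 <= k < n) (geometric C 2^-1 k)%:E)%E).
    by apply: lee_sum => k _; exact: FC.
  rewrite sumEFin lee_fin; apply: geometric_le_lim => //.
  by rewrite ger0_norm// invf_lt1 ?ltr1n.
exists (lim_sup_set F); split; last 1 first.
- move=> w H k0 _; apply: contrapT => nF; apply: H; exists k0 => k k0k Fk.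
  by apply: nF; exists k.
- by apply: bigcap_measurable => // k _; exact: bigcup_measurable.
- exact: lim_sup_set_cvg0.
Qed.

End almost_sure.

(** * Positive frequency of zero rewards under the safe strategy *)

Section frequent_losses.
Variables (R : realType) (G : game R) (r : reward G) (Y : {set state G}).
Variables (rk : state G -> nat).
Hypothesis att : forall s, s \in Y -> attracted r Y Y rk s.

(** Outside [Y] the available actions are a default that makes the strategy total. *)
Let B s : {set action G} := if s \in Y then safe_actions Y s else avail Two s.

Let B0 s : exists a, a \in B s.
Proof.
rewrite /B; case: ifPn => [sY|_]; last exact: avail_nonempty.
have [a sa] := avail_nonempty One s; have [b bs _] := att sY sa.
by exists b.
Qed.

Let B_avail s : B s \subset avail Two s.
Proof.
rewrite /B; case: ifPn => // _.
by apply/fintype.subsetP => b /safe_actionsP[].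
Qed.

Definition safe_strategy : strategy G Two := uniform_strategy B0 B_avail.

Let sigma2 s : fdist R (action G) := safe_strategy [::] s.

Let sigma2_safe s b : s \in Y -> b \in safe_actions Y s -> 0 < sigma2 s b.
Proof. by move=> sY bs; apply: uniform_strategy_gt0; rewrite /B sY. Qed.

Let discount (b : bool) : R := if b then 1 else 2^-1.

(* With eta the least positive probability of a transition, the potential is
   f s = 1 - (eta / 4) * (eta / 2) ^ (rank of s): a decrease of the rank k has
   probability at least eta and gains 2 * (eta / 4) * (eta / 2) ^ k, while a
   loss halves the potential. *)
Lemma potential : exists (f : state G -> R) (rho : R),
  [/\ 0 < rho < 1, forall s, 2^-1 <= f s <= 1 &
    forall s a, s \in Y -> a \in avail One s ->
      \sum_b sigma2 s b *
        (discount (r s a b) * \sum_t trans s a b t * f t) <= rho * f s].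
Proof.
have [eta /andP[eta0 eta1] etaP] := fin_pos_lbound
  (fun x : state G * action G * action G * state G =>
     let: (s, a, b, t) := x in sigma2 s b * trans s a b t).
pose x := eta / 2; pose e := eta / 4.
have [K rkK] : exists K, forall s, (rk s <= K)%N.
  by exists (\max_s rk s)%N => s; exact: (leq_bigmax (F := rk)).
have x0 : 0 < x by rewrite /x; lra.
have x1 : x <= 1 by rewrite /x; lra.
have xn0 n : 0 < x ^+ n by rewrite exprn_gt0.
have xn1 n : x ^+ n <= 1 by rewrite exprn_ile1// ltW.
have xle m n : (m <= n)%N -> x ^+ n <= x ^+ m.
  by move=> mn; apply: ler_wiXn2l => //; exact: ltW.
pose f s : R := 1 - e * x ^+ rk s; pose rho := 1 - e * x ^+ K.
have f1 s : f s <= 1 by rewrite /f gerBl mulr_ge0 ?(ltW (xn0 _))// /e; lra.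
have fe s : 1 - e <= f s by rewrite lerB// ler_piMr// /e; lra.
have f0 s : 2^-1 <= f s by apply: le_trans (fe s); rewrite /e; lra.
have rhoe : 1 - e <= rho by rewrite lerB// ler_piMr// /e; lra.
have rhof s : 1 - e * x ^+ rk s <= rho.
  by rewrite lerB// ler_wpM2l ?xle// /e; lra.
have rho1 : rho < 1 by rewrite gtrBl mulr_gt0// /e; lra.
have rho0 : 0 < rho by move: rhoe; rewrite /e; lra.
exists f, rho; split => [|s|s a sY sa]; rewrite ?rho0 ?rho1 ?f0 ?f1//.
have disc b : 0 < discount b <= 1 by case: b => /=; apply/andP; split; lra.
have Ef1 b c : \sum_t trans s a b t * f t <= 1 - trans s a b c * (1 - f c).
  exact: fdist_sum_le.
have Ef0 b : 0 <= \sum_t trans s a b t * f t.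
  apply: sumr_ge0 => t _; rewrite mulr_ge0 ?fmass_ge0//.
  by have := f0 t; lra.
have le1 b : discount (r s a b) * (\sum_t trans s a b t * f t) <= 1.
  have [t _] := fdist_supp (trans s a b).
  have := Ef1 b t; have := fmass_ge0 (trans s a b) t; have := f1 t.
  have := disc (r s a b); have := Ef0 b; move=> ? /andP[? ?] ? ? ?; nra.
have [b bs rb] := att sY sa.
apply: le_trans (fdist_sum_le _ b le1) _.
have sb0 := sigma2_safe sY bs.
(* If [b] yields reward 0, which has probability at least [eta], the mean is at most 1 - eta/2, and
   this is below the square of 1 - eta/4. *)
have [rb0|[t [_ tt rkt]]] := rb.
  have [t tt] := fdist_supp (trans s a b).
  have : eta <= sigma2 s b * trans s a b t.
    by apply: (etaP (s, a, b, t)); rewrite mulr_gt0.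
  have := fdist_le1 (trans s a b) t.
  have := Ef1 b t; have := f1 t.
  rewrite (negPf rb0) /discount => h1 h2 h3 h4.
  have h5 : sigma2 s b >= eta by nra.
  have h6 : \sum_t trans s a b t * f t <= 1 by nra.
  have h7 : (1 - e) * (1 - e) <= rho * f s by apply: ler_pM => //; rewrite /e; lra.
  apply: le_trans h7; rewrite /e; nra.
(* If the rank drops, the gain is at least 2 e u with u = x^(rk s), because eta = 2 x; then 1 - 2 e
   u is at most the square of 1 - e u. *)
have h1 : eta <= sigma2 s b * trans s a b t.
  by apply: (etaP (s, a, b, t)); rewrite mulr_gt0.
have h2 : discount (r s a b) * (\sum_t trans s a b t * f t) <=
    1 - trans s a b t * (1 - f t).
  by apply: le_trans (Ef1 b t); rewrite ler_piMl//; case/andP: (disc (r s a b)).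
have h3 : 2 * x ^+ rk s <= eta * x ^+ rk t.
  have -> : eta = 2 * x by rewrite /x; lra.
  by rewrite -mulrA ler_wpM2l// -exprS xle.
have h4 : (1 - e * x ^+ rk s) * f s <= rho * f s.
  by rewrite ler_wpM2r// (le_trans _ (f0 s)).
apply: le_trans h4.
have h5 : eta * (e * x ^+ rk t) <= sigma2 s b *
    (1 - discount (r s a b) * \sum_t trans s a b t * f t).
  apply: (@le_trans _ _ (sigma2 s b * (trans s a b t * (1 - f t)))).
    rewrite [leRHS]mulrA ler_pM// ?(ltW eta0)//; last by rewrite /f subKr.
    by rewrite mulr_ge0 ?(ltW (xn0 _))// /e; lra.
  by rewrite ler_wpM2l ?(ltW sb0)//; lra.
have e0 : 0 < e by rewrite /e; lra.
rewrite /f; have := xn0 (rk s); have := xn0 (rk t).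
move: h3 h5; set u := x ^+ rk s; set v := x ^+ rk t => h3 h5 u0 v0.
apply: (@le_trans _ _ (1 - 2 * (e * u))); last by nra.
rewrite lerB//; apply: le_trans h5; nra.
Qed.

Section against.
Variables (s0 : state G) (sigma1 : strategy G One).
Hypothesis s0Y : s0 \in Y.
Local Notation mass := (round_law s0 sigma1 safe_strategy).

Let Inv (h : seq (round G)) : Prop :=
  forall s, 0 < next_state s0 h s -> s \in Y.

Let Inv_rcons h x : Inv h -> 0 < mass h x -> Inv (rcons h x).
Proof.
case: x => -[s a] b hI /=.
have := next_state_ge0 s0 h s; have := fmass_ge0 (sigma1 h s) a.
have := fmass_ge0 (sigma2 s) b => Hb Ha Hs Hm t; rewrite next_state_rcons => tt.
have sY : s \in Y.
  by apply: hI; rewrite lt_neqAle Hs andbT; apply: contraTneq Hm => <-;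
    rewrite !mul0r ltxx.
have sa : a \in avail One s.
  by apply: contraTT Hm => sa; rewrite mixed_move_avail// mulr0 mul0r ltxx.
have : b \in B s by apply: contraTT Hm => /negPf ->; rewrite mul0r mulr0 ltxx.
by rewrite /B sY => /safe_actionsP[_ /(_ a t sa tt)].
Qed.

(** The state of the coming round is not determined by [h], so the supermartingale averages [f] over
    its law. *)
Let loss_potential (f : state G -> R) (h : seq (round G)) : R :=
  2^-1 ^+ losses r h * \sum_s next_state s0 h s * f s.

Let loss_potential_le f rho :
  (forall s a, s \in Y -> a \in avail One s ->
      \sum_b sigma2 s b *
        (discount (r s a b) * \sum_t trans s a b t * f t) <= rho * f s) ->
  forall h, Inv h ->
    \sum_x mass h x * loss_potential f (rcons h x) <= rho * loss_potential f h.
Proof.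
move=> f_le h hI.
(* The factors are nested in the order state, action, reply, transition, so that the hypothesis on
   [f] applies for each state and action. *)
rewrite (eq_bigr (fun x => 2^-1 ^+ losses r h *
  (next_state s0 h x.1.1 * (sigma1 h x.1.1 x.1.2 * (sigma2 x.1.1 x.2 *
   (discount (r x.1.1 x.1.2 x.2) * \sum_t trans x.1.1 x.1.2 x.2 t * f t))))));
  last first.
  move=> [[s a] b] _; rewrite /loss_potential losses_rcons exprD.
  have -> : \sum_t next_state s0 (rcons h (s, a, b)) t * f t =
      \sum_t trans s a b t * f t.
    by apply: eq_bigr => t _; rewrite next_state_rcons.
  rewrite /discount -!/(sigma2 _ _) /=.
  by case: (r s a b) => /=; rewrite ?expr0 ?expr1; ring.
rewrite -mulr_sumr /loss_potential mulrCA ler_wpM2l ?exprn_ge0//.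
rewrite mulr_sumr.
rewrite -(pair_bigA _ (fun u b => next_state s0 h u.1 * (sigma1 h u.1 u.2 *
   (sigma2 u.1 b *
   (discount (r u.1 u.2 b) * \sum_t trans u.1 u.2 b t * f t)))))/=.
rewrite -(pair_bigA _ (fun s a => \sum_b next_state s0 h s * (sigma1 h s a *
   (sigma2 s b * (discount (r s a b) * \sum_t trans s a b t * f t)))))/=.
apply: ler_sum => s _.
have := next_state_ge0 s0 h s; rewrite le_eqVlt => /predU1P[<-|Hs].
  by rewrite !mul0r mulr0 big1// => a _; rewrite big1// => b _; rewrite mul0r.
under eq_bigr => a _ do rewrite -mulr_sumr -mulr_sumr.
rewrite -mulr_sumr mulrCA ler_wpM2l ?(ltW Hs)//.
rewrite -[leRHS]mul1r -[X in X * (rho * _)](fmass_sum1 (sigma1 h s)) mulr_suml.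
apply: ler_sum => a _; have [sa|sa] := boolP (a \in avail One s); last first.
  by rewrite mixed_move_avail// !mul0r.
by rewrite ler_wpM2l ?fmass_ge0//; apply: f_le => //; exact: hI.
Qed.

(** Markov's inequality: with at most k losses the potential is at least 2^-(k+1), because [f] is at
    least 1/2, while its mean after d k rounds is at most 4^-k. *)
Lemma losses_rare f rho d :
  0 < rho -> (forall s, 2^-1 <= f s <= 1) ->
  (forall s a, s \in Y -> a \in avail One s ->
      \sum_b sigma2 s b *
        (discount (r s a b) * \sum_t trans s a b t * f t) <= rho * f s) ->
  rho ^+ d <= 4^-1 ->
  forall k, (Pr s0 sigma1 safe_strategy
    [set w | (losses r (mkseq w (d * k)) <= k)%N] <= (2 * 2^-1 ^+ k)%:E)%E.
Proof.
move=> rho0 f01 f_le rhod k; pose Q h := (losses r h <= k)%N.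
have next_f h : 2^-1 <= \sum_s next_state s0 h s * f s <= 1.
  have cE (c : R) : \sum_s next_state s0 h s * c = c.
    by rewrite -mulr_suml next_state_sum1 mul1r.
  rewrite -[X in X <= _ <= _]cE -[X in _ <= _ <= X]cE.
  apply/andP; split; apply: ler_sum => s _;
    have := f01 s; have := next_state_ge0 s0 h s; nra.
have := expect_prefix (default_round s0) mass (d * k) [::] Q.
rewrite weight_nil mul1r add0n (_ : cylinder [::] = setT) ?setTI => [|//]; last first.
  by apply/seteqP; split.
move=> ->; rewrite lee_fin.
apply: (@le_trans _ _ (expect mass (d * k) [::]
    (fun h => 2 * 2 ^+ k * loss_potential f h))).
  apply: ler_expect => h; rewrite /Q /loss_potential.
  have /andP[h1 h2] := next_f h; case: leqP => lk /=; last first.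
    by rewrite !mulr_ge0 ?exprn_ge0// (le_trans _ h1).
  have : 1 <= 2 ^+ k * 2^-1 ^+ losses r h :> R.
    rewrite exprVn ler_pdivlMr ?exprn_gt0// mul1r.
    by rewrite ler_weXn2l// ler1n.
  rewrite !mulrA -[2 * _ * _]mulrA => h3; nra.
rewrite expectZ.
have := expect_supermartingale (ltW rho0) Inv_rcons (loss_potential_le f_le)
  (d * k) (h := [::]).
have I0 : Inv [::] by move=> s /=; case: eqP => [->//|_]; rewrite ltxx.
move=> /(_ I0) H.
apply: le_trans (ler_wpM2l _ H) _; first by rewrite mulr_ge0 ?exprn_ge0.
rewrite /loss_potential /losses/= expr0 mul1r.
have /andP[h1 h2] := next_f [::].
rewrite -mulrA ler_wpM2l// mulrA exprM.
have : (rho ^+ d) ^+ k <= 4^-1 ^+ k.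
  by rewrite lerXn2r ?nnegrE ?exprn_ge0 ?(ltW rho0).
move=> h3; apply: (@le_trans _ _ (2 ^+ k * 4^-1 ^+ k * 1)).
  rewrite ler_pM ?mulr_ge0 ?exprn_ge0 ?(ltW rho0) ?(le_trans _ h1)//.
  by rewrite ler_wpM2l ?exprn_ge0.
rewrite mulr1 -exprMn (_ : 2 * 4^-1 = 2^-1 :> R)//; lra.
Qed.
End against.

(** By Borel-Cantelli, almost surely more than k of the first d k rewards are 0 for all large k. *)
Lemma safe_strategy_wins : exists2 c : R, 0 < c &
  forall L s, s \in Y ->
    almost_sure_winning2 safe_strategy (less_than L r (1 - c)) s.
Proof.
have [f [rho [/andP[rho0 rho1] f01 f_le]]] := potential.
have [d d0 rhod] : exists2 d, (0 < d)%N & rho ^+ d <= 4^-1.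
  have /cvgrPdist_lt/(_ 4^-1) : GRing.exp rho @ \oo --> 0.
    by apply: cvg_expr; rewrite gtr0_norm.
  rewrite invr_gt0 ltr0n => /(_ isT)[n _ /(_ n.+1 (leqnSn n))] /=.
  rewrite sub0r normrN ger0_norm ?exprn_ge0 ?(ltW rho0)// => H.
  by exists n.+1 => //; exact: ltW.
have dV0 : 0 < d%:R^-1 :> R by rewrite invr_gt0 ltr0n.
(* The payoff is almost surely at most 1 - 1/d; halving 1/d makes the inequality strict. *)
exists (d%:R^-1 / 2) => [|L s sY sigma1]; first by rewrite divr_gt0.
apply: prob1_ae; first exact: measurable_less_than.
have := ae_eventually_not
  (fun k => measurable_prefix (d * k) (fun h => losses r h <= k)%N)
  (losses_rare sigma1 sY rho0 f01 f_le rhod).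
apply: filterS => w [k0 wk0] /=.
have := @payoff_le_losses _ _ r L w d k0 d0.
move=> H; apply: (le_lt_trans (H _)) => [k kk0|].
  by rewrite ltnNge; apply/negP; exact: wk0.
by rewrite lte_fin ltrD2l ltrN2; lra.
Qed.
End frequent_losses.

(** * Player 1: Markov strategies *)

Section escape.
Variables (R : realType) (G : game R) (r : reward G) (Y : {set state G}).
Variables (rk : state G -> nat) (act : state G -> action G).
Hypothesis act_avail : forall s, act s \in avail One s.
Hypothesis act_escaping : forall s, s \notin Y -> forall b, b \in avail Two s ->
  (r s (act s) b /\
   forall t, 0 < trans s (act s) b t -> t \notin Y /\ (rk t <= rk s)%N)
  \/ exists a' t, [/\ a' \in avail One s, 0 < trans s a' b t,
       t \notin Y & (rk t < rk s)%N].

Let halves01 n : 0 <= (2^-1 : R) ^+ n <= 1.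
Proof. by rewrite exprn_ge0//= exprn_ile1// invf_le1 ?ler1n. Qed.

(** The deviation probabilities 2^-(n+2) are those of [expect_stay]; over all rounds n they sum to
    1/2. *)
Definition escape_strategy : strategy G One.
Proof.
refine (@Strategy R G One (fun x s => mixture (halves01 (size x).+2)
  (point_mass R (act s)) (uniform R (avail_nonempty One s))) _) => x s a sa.
rewrite [LHS](_ : _ = (1 - 2^-1 ^+ (size x).+2) * point_mass R (act s) a +
  2^-1 ^+ (size x).+2 * uniform R (avail_nonempty One s) a)// point_massE.
have /negPf -> : a != act s by apply: contraNneq sa => ->.
by rewrite /= (negPf sa) mul0r !mulr0 addr0.
Defined.

Lemma escape_strategy_markov : markov_strategy escape_strategy.
Proof. by move=> x y s xy a /=; rewrite xy. Qed.

Lemma escape_strategy_gt0 x s a : a \in avail One s ->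
  0 < escape_strategy x s a.
Proof.
move=> sa; apply: ltr_wpDl.
  by rewrite mulr_ge0 ?fmass_ge0// subr_ge0; case/andP: (halves01 (size x).+2).
rewrite mulr_gt0 ?exprn_gt0// /= sa divr_gt0 ?ltr0n//.
by apply/card_gt0P; exists a.
Qed.

Lemma escape_strategy_act x s :
  1 - 2^-1 ^+ (size x).+2 <= escape_strategy x s (act s).
Proof.
apply: ler_wpDr; first by rewrite mulr_ge0 ?fmass_ge0 ?exprn_ge0.
by rewrite point_massE eqxx mulr1.
Qed.

Section against.
Variables (s0 : state G) (sigma2 : strategy G Two).
Hypothesis s0Y : s0 \notin Y.
Local Notation mass := (round_law s0 escape_strategy sigma2).
Local Notation W := (weight (default_round s0) mass).

Let reach k h s :=
  [/\ 0 < W h, 0 < next_state s0 h s, s \notin Y & (rk s <= k)%N].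

Let W_rcons h s a b : 0 < W h -> 0 < next_state s0 h s ->
  a \in avail One s -> 0 < sigma2 h s b -> 0 < W (rcons h (s, a, b)).
Proof.
move=> Wh hs sa sb; rewrite weight_rcons mulr_gt0//= !mulr_gt0//.
exact: escape_strategy_gt0.
Qed.

Lemma escape_strategy_wins L :
  (0 < Pr s0 escape_strategy sigma2 (at_least L r 1))%E.
Proof.
have reach0 : exists k, `[< exists h s, reach k h s >].
  exists (rk s0); apply/asboolP; exists [::], s0.
  by split; rewrite ?weight_nil//= eqxx.
have [k /asboolP[h0 [s1 [Wh0 h0s1 s1Y s1k]]] kmin] := ex_minnP reach0.
(* Otherwise a state of rank less than k would be reachable. *)
have key h s b : reach k h s -> 0 < sigma2 h s b ->
    r s (act s) b /\
    forall t, 0 < trans s (act s) b t -> t \notin Y /\ (rk t <= k)%N.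
  move=> [Wh hs sY sk] sb.
  have sb' : b \in avail Two s.
    by apply: contraTT sb => sb; rewrite mixed_move_avail// ltxx.
  have [[rs H]|[a' [t [sa' tt tY rkt]]]] := act_escaping sY sb'.
    by split => // t /H[tY rkt]; split => //; apply: leq_trans sk.
  have := kmin (rk t); rewrite (_ : `[< _ >] = true); last first.
    apply/asboolP; exists (rcons h (s, a', b)), t; split => //.
      exact: W_rcons.
    by rewrite next_state_rcons.
  by move=> /(_ isT); rewrite leqNgt (leq_trans rkt).
(* Goodness constrains all possible successors, so it can be read off a single round. *)
pose good (x : round G) := let: (s, a, b) := x in
  r s a b && [forall t, (0 < trans s a b t) ==> (t \notin Y) && (rk t <= k)%N].
(* The length is strictly greater so that the last round is good and controls the next state. *)
pose Q h := [&& (size h0 < size h)%N, 0 < W h & all good (drop (size h0) h)].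
have good_act h s b : reach k h s -> 0 < sigma2 h s b -> good (s, act s, b).
  move=> hs /(key _ _ _ hs)[rs H]; rewrite /good rs.
  by apply/forallP => t; apply/implyP => /H[-> ->].
have Qrcons h x : (size h0 <= size h)%N ->
    Q (rcons h x) = [&& 0 < W (rcons h x), all good (drop (size h0) h) & good x].
  move=> hh; rewrite /Q size_rcons ltnS hh drop_rcons// all_rcons.
  by rewrite [good x && _]andbC.
have [b1 s1b1] := fdist_supp (sigma2 h0 s1).
pose h1 := rcons h0 (s1, act s1, b1).
have Wh1 : 0 < W h1 by exact: W_rcons.
have Qh1 : Q h1.
  by rewrite Qrcons// Wh1 drop_size (good_act h0)//; split.
have Q_reach h s : Q h -> 0 < next_state s0 h s -> reach k h s.
  case/lastP: h => [|h x]; first by rewrite /Q ltn0.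
  move=> Qh; have := Qh; rewrite {1}/Q size_rcons ltnS => /andP[hh _].
  move: Qh; rewrite Qrcons// => /and3P[Wh _]; case: x Wh => -[s' a'] b' Wh.
  rewrite next_state_rcons => /andP[_ /forallP/(_ s)/implyP H] ts.
  by have /andP[] := H ts; split; rewrite ?next_state_rcons.
have stay h : Q h ->
    1 - 2^-1 ^+ (size h).+2 <= \sum_(x | Q (rcons h x)) mass h x.
  move=> Qh; have /and3P[hh Wh gh] := Qh.
  (* Only rounds in which player 1 plays [act] are counted: whatever the reply, those of positive
     mass are good. *)
  apply: (@le_trans _ _ (\sum_x next_state s0 h x.1.1 *
    ((x.1.2 == act x.1.1)%:R * escape_strategy h x.1.1 x.1.2 *
      sigma2 h x.1.1 x.2))).
    rewrite -(pair_bigA _ (fun u b => next_state s0 h u.1 *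
      ((u.2 == act u.1)%:R * escape_strategy h u.1 u.2 * sigma2 h u.1 b)))/=.
    rewrite -(pair_bigA _ (fun s a => \sum_b next_state s0 h s *
      ((a == act s)%:R * escape_strategy h s a * sigma2 h s b)))/=.
    rewrite -[leLHS]mul1r -[X in X * _](next_state_sum1 s0 h) mulr_suml.
    apply: ler_sum => s _.
    under eq_bigr do rewrite -mulr_sumr -mulr_sumr fmass_sum1 mulr1.
    rewrite -mulr_sumr ler_wpM2l ?next_state_ge0//.
    rewrite (bigD1 (act s))//= eqxx mul1r big1 ?addr0.
      exact: escape_strategy_act.
    by move=> a /negPf ->; rewrite mul0r.
  rewrite [leRHS]big_mkcond/=; apply: ler_sum => -[[s a] b] _ /=.
  have := next_state_ge0 s0 h s; rewrite le_eqVlt => /predU1P[<-|hs].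
    by rewrite !mul0r if_same.
  have := fmass_ge0 (sigma2 h s) b; rewrite le_eqVlt => /predU1P[<-|sb].
    by rewrite !mulr0 if_same.
  case: eqP => [->|_]; last first.
    rewrite !mul0r mulr0; case: ifP => // _.
    exact: (round_mass_ge0 s0 escape_strategy sigma2 h (s, a, b)).
  rewrite Qrcons ?(ltnW hh)// W_rcons// gh (good_act h)//=; last exact: Q_reach.
  by rewrite mul1r mulrA.
have Qprefix h x : (size h1 <= size h)%N -> Q (rcons h x) -> Q h.
  rewrite size_rcons => hh; rewrite Qrcons ?(ltnW hh)// => /and3P[Wh gh _].
  rewrite /Q hh gh andbT lt_neqAle weight_ge0 andbT.
  by apply: contraTneq Wh; rewrite weight_rcons => <-; rewrite mul0r ltxx.
apply: lt_le_trans (prob_stay stay Qprefix Qh1 Wh1) _.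
apply: le_measure; rewrite ?inE;
  [exact: measurable_stay|exact: measurable_at_least|].
move=> w Qw; apply: (@payoff_ge1 _ _ _ _ _ (size h1)) => n hn.
have := Qw n.+1 (leqW hn).
rewrite mkseqS Qrcons ?size_mkseq; last by rewrite (leq_trans _ hn)// size_rcons.
by case: (w n) => -[s a] b /and3P[_ _ /andP[]].
Qed.

End against.
End escape.

(** * Determinacy and memory *)

Section determinacy.
Variables (R : realType) (G : game R) (r : reward G).

(** The set [Y] is common to both values of [L], and the gap between the thresholds 1 and [1 - c]
    decides the objectives with threshold 1 and those with thresholds close to 1 alike. *)
Theorem limavg_determinacy : exists (Y : {set state G}) (c : R)
    (sigma1 : strategy G One) (sigma2 : strategy G Two),
  [/\ 0 < c, markov_strategy sigma1,
      stationary_strategy sigma2 /\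
        (forall s : state G, patience sigma2 <= (max_actions G)%:R),
      forall L s, s \notin Y -> positive_winning1 sigma1 (at_least L r 1) s &
      forall L s, s \in Y ->
        almost_sure_winning2 sigma2 (less_than L r (1 - c)) s].
Proof.
have [Y [rk [rk' [att esc]]]] := attractor_dichotomy r.
have [c c0 sigma2_wins] := safe_strategy_wins att.
have [s|act act_esc] := @choice _ _ (fun s a => a \in avail One s /\
  (s \notin Y -> forall b, b \in avail Two s ->
    (r s a b /\ forall t, 0 < trans s a b t -> t \notin Y /\ (rk' t <= rk' s)%N)
    \/ exists a' t, [/\ a' \in avail One s, 0 < trans s a' b t,
         t \notin Y & (rk' t < rk' s)%N])).
  have [sY|sY] := boolP (s \in Y).
    by have [a sa] := avail_nonempty One s; exists a.
  by have [a sa H] := esc s sY; exists a.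
exists Y, c, (escape_strategy (fun s => proj1 (act_esc s))), (safe_strategy att).
split => //.
- exact: escape_strategy_markov.
- split; first exact: uniform_strategy_stationary.
  by move=> s; exact: patience_uniform s.
- move=> L s sY sigma2; apply: (@escape_strategy_wins _ _ _ Y rk') => // t tY.
  exact: (proj2 (act_esc t)).
Qed.

Lemma at_least_sub L (l l' : R) : l <= l' ->
  at_least L r l' `<=` at_least L r l.
Proof. by move=> ll' w /=; apply: le_trans; rewrite lee_fin. Qed.

Lemma less_than_sub L (l l' : R) : l <= l' ->
  less_than L r l `<=` less_than L r l'.
Proof. by move=> ll' w /= /lt_le_trans; apply; rewrite lee_fin. Qed.

Lemma positive_winning1_le L (l l' : R) (sigma1 : strategy G One) s :
  l <= l' -> positive_winning1 sigma1 (at_least L r l') s ->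
  positive_winning1 sigma1 (at_least L r l) s.
Proof.
move=> ll' win sigma2; apply: lt_le_trans (win sigma2) _.
by apply: le_measure; rewrite ?inE; [exact: measurable_at_least..|];
  exact: at_least_sub.
Qed.

Lemma almost_sure_winning2_le L (l l' : R) (sigma2 : strategy G Two) s :
  l <= l' -> almost_sure_winning2 sigma2 (less_than L r l) s ->
  almost_sure_winning2 sigma2 (less_than L r l') s.
Proof.
move=> ll' win sigma1; apply/eqP; rewrite eq_le probability_le1//=; last first.
  exact: measurable_less_than.
rewrite -(win sigma1).
by apply: le_measure; rewrite ?inE; [exact: measurable_less_than..|];
  exact: less_than_sub.
Qed.

Lemma positive_winning1_LimInf L (l : R) (sigma1 : strategy G One) s :
  positive_winning1 sigma1 (at_least LimInf r l) s ->
  positive_winning1 sigma1 (at_least L r l) s.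
Proof.
move=> win sigma2; apply: lt_le_trans (win sigma2) _.
apply: le_measure; rewrite ?inE; [exact: measurable_at_least..|].
by move=> w /= lw; apply: (le_trans lw); case: L => //=; exact: limn_einf_sup.
Qed.

Lemma winning_exclusive L (l l' : R) (sigma1 : strategy G One)
    (sigma2 : strategy G Two) s : l <= l' ->
  positive_winning1 sigma1 (at_least L r l') s ->
  ~ almost_sure_winning2 sigma2 (less_than L r l) s.
Proof.
move=> ll' win1 win2.
have := win1 sigma2; rewrite (_ : at_least L r l' = ~` less_than L r l').
  rewrite probability_setC; last exact: measurable_less_than.
  by rewrite (almost_sure_winning2_le ll' win2) subee// ltxx.
apply/seteqP; split => w; first by rewrite /at_least/= leNgt => /negP.
by move=> /negP; rewrite -leNgt.
Qed.

End determinacy.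

(** * Counting memory states, and the clock of a Markov strategy *)

Section memory_bounds.
Variables (R : realType) (G : game R) (Mem : Type).

Lemma finite_short_seqs (T : finType) n :
  finite_set [set x : seq T | (size x < n)%N].
Proof.
apply: (@sub_finite_set _ _ (\bigcup_(k in `I_n) (@tval k T @` setT))).
  move=> x /= xn; exists (size x) => //=; exists (in_tuple x) => //.
by apply: bigcup_finite => // k _; apply: finite_image; exact: finite_finset.
Qed.

Lemma leq_Theta (M : memory_rep G Mem) (f : nat -> seq (round G)) T :
  (forall n, size (f n) = n) ->
  (forall i j, (i < j < T)%N -> memory_after M (f i) <> memory_after M (f j)) ->
  (T <= Theta M T)%N.
Proof.
move=> size_f f_inj.
pose s : seq {classic Mem} := [seq memory_after M (f i) | i <- iota 0 T].
have s_uniq : uniq s.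
  rewrite map_inj_in_uniq ?iota_uniq// => i j.
  rewrite !mem_iota !add0n /= => iT jT.
  move=> ij; have [lt_ij|lt_ji|//] := ltngtP i j; exfalso.
    by apply: f_inj ij; rewrite lt_ij.
  by apply: (@f_inj j i); rewrite ?lt_ji.
apply: (@leq_trans #|` [fset x in s]%fset|).
  by rewrite card_fseq undup_id// size_map size_iota.
apply: fsubset_leq_card; apply/fsubsetP => x; rewrite inE/= => /mapP[i].
rewrite mem_iota add0n => /= iT ->.
rewrite in_fset_set; first by apply/mem_set; exists (f i) => //=; rewrite size_f.
by apply: finite_image; exact: finite_short_seqs.
Qed.

End memory_bounds.

Section clock.
Variables (R : realType) (G : game R) (s0 : state G).

Lemma memory_after_clock (next : state G -> nat -> fdist R (action G)) x :
  memory_after (clock_rep next) x = size x.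
Proof.
rewrite /memory_after /=.
have foldE n : foldl (fun m (y : round G) => let: (_, _, _) := y in m.+1) n x =
    (n + size x)%N.
  elim: x n => [|[[s a] b] x IH] n /=; first by rewrite addn0.
  by rewrite IH addSnnS.
exact: foldE 0%N.
Qed.

Lemma Theta_clock (next : state G -> nat -> fdist R (action G)) T :
  Theta (clock_rep next) T = T.
Proof.
apply/eqP; rewrite eqn_leq; apply/andP; split; last first.
  apply: (@leq_Theta _ _ _ _ (fun n => nseq n (default_round s0))) => [n|i j].
    by rewrite size_nseq.
  by rewrite !memory_after_clock !size_nseq => /andP[+ _] ij; rewrite ij ltnn.
pose s : seq {classic nat} := [seq (i : {classic nat}) | i <- iota 0 T].
apply: (@leq_trans #|` [fset x in s]%fset|); last first.
  by rewrite card_fseq (leq_trans (size_undup _))// size_map size_iota.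
apply: fsubset_leq_card; apply/fsubsetP => x.
rewrite in_fset_set; last by apply: finite_image; exact: finite_short_seqs.
move=> /set_mem[h /= hT <-]; rewrite memory_after_clock inE/=.
by apply/(@mapP nat {classic nat}); exists (size h) => //; rewrite mem_iota.
Qed.

Lemma markov_clock i (sigma : strategy G i) : markov_strategy sigma ->
  exists next : state G -> nat -> fdist R (action G),
    represents (clock_rep next) sigma.
Proof.
(* Strategies are defined on all sequences of rounds, so a constant sequence can stand for its
   length. *)
move=> markov; exists (fun s n => sigma (nseq n (default_round s0)) s) => x s.
by rewrite memory_after_clock; apply: markov; rewrite size_nseq.
Qed.

End clock.

(** * Lower bounds *)

Section gamble.
Variable R : realType.

Let all_avail (_ : player) (_ : option bool) : {set bool} := [set: bool]%SET.

Let all_avail_nonempty i s : exists a, a \in all_avail i s.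
Proof. by exists true; rewrite inE. Qed.

(* In state None player 1 chooses whether to gamble (true) and player 2 whether
   to deny the reward of the round (true).  A gamble leads to one of the
   absorbing states Some true and Some false, won and lost by player 1; it is
   won exactly when the reward is denied. *)
Definition gamble_trans (s : option bool) (a b : bool) : fdist R (option bool) :=
  point_mass R (if s is None then if a then Some b else None else s).

Definition gamble : game R := Game all_avail_nonempty gamble_trans.

Definition gamble_reward : reward gamble :=
  fun s _ b => if s is Some won then won else ~~ b.

Let s0 : state gamble := None.

Lemma gamble_transE (s t : state gamble) a b : trans s a b t =
  (t == if s is None then if a then Some b else None else s)%:R.
Proof. exact: point_massE. Qed.

(** Not gambling is the main action; if the reward is denied, a gamble wins and lowers the rank from
    1 at [None] to 0 at [Some true]. *)
Lemma gamble_positive : Positive1 (at_least LimInf gamble_reward 1) s0.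
Proof.
have act_avail (s : state gamble) : false \in avail One s by rewrite inE.
pose rk (s : state gamble) : nat := if s is None then 1%N else 0%N.
exists (escape_strategy act_avail) => sigma2.
pose Y : {set state gamble} := [set Some false : state gamble]%SET.
apply: (@escape_strategy_wins R gamble gamble_reward Y rk); last first.
  by rewrite inE.
move=> s sY b _; case: s sY => [[]|] sY; last 1 first.
- case: b; [right|left].
    exists true, (Some true); split; rewrite ?inE//.
    by rewrite gamble_transE eqxx.
  by split => // t; rewrite gamble_transE; case: eqP => [->|_]; rewrite ?inE ?ltxx.
- left; split => // t; rewrite gamble_transE.
  by case: eqP => [->|_]; rewrite ?inE ?ltxx.
- by rewrite inE eqxx in sY.
Qed.

Section infinite_memory.
Variables (sigma1 : strategy gamble One) (Mem : Type).
Variables (M : memory_rep gamble Mem).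
Hypothesis M_sigma1 : represents M sigma1.

Let denies (x : seq (round gamble)) : bool := sigma1 x s0 true == 0.

(* The reward is denied only when a gamble has probability zero, so that every
   gamble is lost. *)
Let sigma2 : strategy gamble Two.
Proof.
refine (@Strategy R gamble Two (fun x _ => point_mass R (denies x)) _) => x s b.
by rewrite inE.
Defined.

(** As [sigma2] is deterministic, this is the only history of length n against it without a
    gamble. *)
Fixpoint cautious (n : nat) : seq (round gamble) :=
  if n is n'.+1 then
    rcons (cautious n') (s0, false, denies (cautious n')) else [::].

Lemma size_cautious n : size (cautious n) = n.
Proof. by elim: n => //= n IH; rewrite size_rcons IH. Qed.

Let next_cautious n s : next_state s0 (cautious n) s = (s == s0)%:R.
Proof. by case: n => [//|n]; rewrite /= next_state_rcons gamble_transE. Qed.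

Let risk n : R := sigma1 (cautious n) s0 true.

Let sigma1_false n : sigma1 (cautious n) s0 false = 1 - risk n.
Proof.
by rewrite -(fmass_sum1 (sigma1 (cautious n) s0)) big_bool/= addrAC subrr add0r.
Qed.

Local Notation mass := (round_law s0 sigma1 sigma2).
Local Notation W := (weight (default_round s0) mass).
Local Notation P := (Pr s0 sigma1 sigma2).

Let weight_cautious n : W (cautious n.+1) = W (cautious n) * (1 - risk n).
Proof.
rewrite /= weight_rcons; congr (_ * _).
by rewrite round_lawE next_cautious eqxx sigma1_false mul1r point_massE eqxx mulr1.
Qed.

(** The first departure from the cautious history is a gamble of positive probability; hence the
    reward was not denied and the gamble is lost for good. *)
Let absorbed (w : play gamble) n : (forall n, 0 < W (mkseq w n)) ->
  mkseq w n = cautious n -> w n <> (s0, false, denies (cautious n)) ->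
  (payoff LimSup gamble_reward w <= 0)%E.
Proof.
move=> Wpos wn wn'; have step := weight_gt0_step _ Wpos.
suff lost : forall k, (n < k)%N -> (w k).1.1 = Some false.
  apply: (@payoff_le0 _ _ _ _ _ n.+1) => k /lost.
  by case: (w k) => -[s a] b /= ->.
have w_trans k : 0 < trans (w k).1.1 (w k).1.2 (w k).2 (w k.+1).1.1.
  have := step k.+1; rewrite mkseqS.
  case: (w k) => -[s a] b; case: (w k.+1) => -[s' a'] b'.
  rewrite round_lawE next_state_rcons => H.
  rewrite lt_neqAle fmass_ge0 andbT.
  by apply: contraTneq H => /= <-; rewrite !mul0r ltxx.
elim=> // k IH; rewrite ltnS leq_eqVlt => /predU1P[nk|/IH wk]; last first.
  have := w_trans k; rewrite wk gamble_transE.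
  by case: eqP => [//|_]; rewrite ltxx.
subst k; have := w_trans n; have := step n; rewrite wn.
move: wn'; case: (w n) => -[s a] b wn'.
rewrite round_lawE point_massE.
case: (b =P _) => [bE|_]; last by rewrite mulr0 ltxx.
rewrite mulr1 => ns.
have sE : s = s0.
  apply/eqP; apply: contraTT ns => /negPf sN.
  by rewrite next_cautious sN mul0r ltxx.
have aE : a = true by case: a wn' {ns} => // -[]; rewrite sE bE.
have bF : b = false.
  rewrite bE /denies; apply: contraTF ns => /eqP.
  by rewrite sE aE => ->; rewrite mulr0 ltxx.
by rewrite sE aE bF gamble_transE; case: eqP => [//|_]; rewrite ltxx.
Qed.

(** A repeated memory state makes the memory along the cautious history periodic, and the payoff
    against [sigma2] is then almost surely at most 0. *)
Lemma no_collision L (l : R) i j : 0 < l ->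
  positive_winning1 sigma1 (at_least L gamble_reward l) s0 -> (i < j)%N ->
  memory_after M (cautious i) <> memory_after M (cautious j).
Proof.
move=> l0 win ij mij.
pose D := (j - i)%N.
have D0 : (0 < D)%N by rewrite subn_gt0.
(* Equal memory gives equal mixing at [None], hence equal replies of [sigma2] and equal updates. *)
have mE n : (i <= n)%N ->
    memory_after M (cautious (n + D)) = memory_after M (cautious n).
  move=> /subnKC <-; elim: (n - i)%N => [|k IH].
    by rewrite addn0 subnKC// ltnW.
  rewrite addnS addSn /= /memory_after -!cats1 !foldl_cat /=.
  rewrite -!/(memory_after M _) IH.
  by rewrite /denies !M_sigma1 IH.
have riskE n : (i <= n)%N -> risk (n + D) = risk n.
  by move=> hn; rewrite /risk !M_sigma1 mE.
have risk01 n : 0 <= risk n <= 1 by rewrite fmass_ge0 fdist_le1.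
suff : P (at_least L gamble_reward l) = 0%E.
  by have := win sigma2 => /[swap] ->; rewrite ltxx.
have sub_le (w : play gamble) : at_least L gamble_reward l w ->
    ~ (payoff LimSup gamble_reward w <= 0)%E.
  move=> lw w0; suff : (l%:E <= 0)%E by rewrite lee_fin leNgt l0.
  apply: le_trans w0; apply: (le_trans lw).
  by case: L {win lw} => //=; exact: limn_einf_sup.
(* Without risk from round [i] on, every later reward along the cautious history is denied. *)
have [[k ik risk_k]|norisk] := pselect (exists2 k, (i <= k)%N & 0 < risk k);
  last first.
  apply: (@prob0_positive_weight _ _ _ _ _ set0) => [|||w Wpos /sub_le].
  - exact: measurable_at_least.
  - exact: measurable0.
  - exact: measure0.
  apply.
  have [[n]|wE] := pselect (exists n, mkseq w n = cautious n /\
      w n <> (s0, false, denies (cautious n))).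
    by move=> [wn wn']; exact: absorbed wn wn'.
  have wn n : mkseq w n = cautious n.
    elim: n => [//|n IH]; rewrite mkseqS /= IH; congr rcons.
    by apply: contrapT => wn; apply: wE; exists n.
  apply: (@payoff_le0 _ _ _ _ _ i) => n hn.
  have -> : w n = (s0, false, denies (cautious n)).
    by apply: contrapT => wn'; apply: wE; exists n.
  rewrite /= negbK /denies eq_le fmass_ge0 andbT leNgt.
  by apply/negP => rn; apply: norisk; exists n.
pose N : set (iseq_space (default_round s0)) := \bigcap_n cylinder (cautious n).
have mN : measurable N.
  by apply: bigcapT_measurable => n; exact: measurable_cylinder.
(* The risk at [k] recurs every [D] rounds, so never gambling has probability 0. *)
have W_le m : W (cautious (k + m * D)) <= (1 - risk k) ^+ m.
  have Wanti n q : W (cautious (n + q)) <= W (cautious n).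
    elim: q => [|q IH]; first by rewrite addn0.
    rewrite addnS weight_cautious (le_trans _ IH)// ler_piMr ?weight_ge0//.
    by have := risk01 (n + q)%N; lra.
  have risk_km q : risk (k + q * D) = risk k.
    elim: q => [|q IH]; first by rewrite addn0.
    by rewrite mulSn addnCA addnC riskE// (leq_trans ik)// leq_addr.
  elim: m => [|m IH].
    rewrite addn0 expr0; have := Wanti 0%N k; rewrite add0n => /le_trans; apply.
    by rewrite weight_nil.
  rewrite mulSn addnCA addnC -(prednK D0) addnS -addSn.
  apply: le_trans (Wanti _ _) _; rewrite weight_cautious prednK// risk_km exprSr.
  by rewrite ler_wpM2r//; have := risk01 k; lra.
have PN : P N = 0%E.
  apply/eqP; rewrite eq_le measure_ge0 andbT.
  apply/lee_addgt0Pr => e e0; rewrite add0e.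
  have /cvgrPdist_lt/(_ e e0) : GRing.exp (1 - risk k) @ \oo --> 0.
    by apply: cvg_expr; rewrite ger0_norm; have := risk01 k; lra.
  move=> [m _ /(_ m (leqnn m))] /=; rewrite sub0r normrN => Hm.
  apply: (@le_trans _ _ (P (cylinder (cautious (k + m * D))))).
    apply: le_measure; rewrite ?inE//; first exact: measurable_cylinder.
    by move=> w; apply.
  rewrite [leLHS]law_of_cylinder lee_fin (le_trans (W_le m))//.
  by rewrite (le_trans (ler_norm _))// ltW.
apply: (@prob0_positive_weight _ _ _ _ _ N) => // [|w Wpos /sub_le lw].
  exact: measurable_at_least.
have [[n [wn wn']]|wE] := pselect (exists n, mkseq w n = cautious n /\
    w n <> (s0, false, denies (cautious n))); first by case: lw; exact: absorbed wn wn'.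
move=> n _; rewrite /cylinder/= size_cautious.
elim: n => [//|n IH]; rewrite mkseqS /= IH; congr rcons.
by apply: contrapT => wn; apply: wE; exists n.
Qed.

End infinite_memory.
End gamble.

(** * The one-state game that forces patience m *)

Section mismatch.
Variables (R : realType) (m' : nat).
Local Notation m := m'.+1.

Let all_avail (_ : player) (_ : unit) : {set 'I_m} := [set: 'I_m]%SET.

Let all_avail_nonempty i s : exists a, a \in all_avail i s.
Proof. by exists ord0; rewrite inE. Qed.

Definition mismatch : game R :=
  Game all_avail_nonempty (fun _ _ _ => point_mass R tt).

Definition mismatch_reward : reward mismatch := fun _ a b => a != b.

Lemma mismatch_card_avail i (s : state mismatch) : #|avail i s| = m.
Proof. by rewrite cardsT card_ord. Qed.

(** Copying the action of player 1 is a safe reply with reward 0, so the only state is attracted. *)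
Lemma mismatch_winning : exists2 c : R, 0 < c &
  exists sigma2 : strategy mismatch Two, forall L,
    almost_sure_winning2 sigma2 (less_than L mismatch_reward (1 - c)) tt.
Proof.
have att (s : state mismatch) : s \in [set: state mismatch]%SET ->
    attracted mismatch_reward [set: state mismatch]%SET
      [set: state mismatch]%SET (fun=> 0%N) s.
  move=> _ a _; exists a; last by left; rewrite /mismatch_reward negbK.
  by apply/safe_actionsP; split => [|? t _ _]; rewrite inE.
have [c c0 win] := safe_strategy_wins att.
by exists c => //; exists (safe_strategy att) => L; apply: win; rewrite inE.
Qed.

(** If [b] had probability 0, player 1 could play it forever and almost surely receive reward 1 in
    every round. *)
Lemma mismatch_support L (sigma2 : strategy mismatch Two) (b : 'I_m) :
  stationary_strategy sigma2 ->
  almost_sure_winning2 sigma2 (less_than L mismatch_reward 1) tt ->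
  0 < sigma2 [::] tt b.
Proof.
move=> stat win; rewrite lt_neqAle fmass_ge0 andbT eq_sym.
apply/eqP => b0.
have b_avail x (s : state mismatch) a : a \notin avail One s ->
  (fun (_ : seq (round mismatch)) (_ : state mismatch) => point_mass R b) x s a = 0.
  by rewrite inE.
pose sigma1 : strategy mismatch One := Strategy b_avail.
suff : @Pr R mismatch tt sigma1 sigma2 (less_than L mismatch_reward 1) = 0%E.
  by rewrite win => /eqP; rewrite onee_eq0.
apply: (@prob0_positive_weight _ _ _ _ _ set0) => [|||w Wpos].
- exact: measurable_less_than.
- exact: measurable0.
- exact: measure0.
apply/negP; rewrite -leNgt.
apply: (@payoff_ge1 _ _ _ _ _ 0%N) => n _.
have := weight_gt0_step n Wpos; case: (w n) => -[[] a] b'.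
rewrite round_lawE [sigma1 _ _ _]point_massE.
case: eqP => [->|_]; last by rewrite mulr0 mul0r ltxx.
rewrite /= /mismatch_reward; apply: contraTneq => <-.
by rewrite (stat _ [::]) b0 mulr0 ltxx.
Qed.

(** All m actions have probability at least the minimum q, so m q is at most 1. *)
Lemma mismatch_patience L (sigma2 : strategy mismatch Two) :
  stationary_strategy sigma2 ->
  almost_sure_winning2 sigma2 (less_than L mismatch_reward 1) tt ->
  m%:R <= patience sigma2.
Proof.
move=> stat win; have supp b := mismatch_support b stat win.
rewrite /patience; set q := \big[_/_]_(_ | _) _.
have q0 : 0 < q.
  rewrite /q; elim/big_ind: _ => // [x y x0 y0|u u0]; first by rewrite lt_min x0.
  by rewrite lt_neqAle eq_sym u0 fmass_ge0.
have q_le (b : 'I_m) : q <= sigma2 [::] tt b.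
  by apply: (bigmin_le_cond _ (j := (tt, b))); rewrite gt_eqF.
rewrite -[q^-1]mul1r ler_pdivlMr// -[leRHS](fmass_sum1 (sigma2 [::] tt)).
apply: (@le_trans _ _ (\sum_(b : 'I_m) q)); last by apply: ler_sum => b _.
by rewrite sumr_const card_ord mulr_natl.
Qed.

End mismatch.

(** * The bounds for both players, from determinacy and the two example games *)

Theorem theorem18 (R : realType) :
  (* Player 1 *)
  [/\ (* infinite memory is required in general *)
      exists (G : game R) (r : reward G) (s : state G),
        Positive1 (at_least LimInf r 1) s /\
        forall eps : R, 0 <= eps < 1 ->
        forall sigma1 : strategy G One, finite_memory sigma1 ->
        forall L : limavg,
          ~ positive_winning1 sigma1 (at_least L r (1 - eps)) s,
      (* Markov strategies suffice *)
      forall (G : game R) (r : reward G) (s : state G) (L : limavg),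
        Positive1 (at_least L r 1) s \/
        (forall eps : R, 0 < eps -> Positive1 (at_least L r (1 - eps)) s) ->
        (exists sigma1 : strategy G One,
           markov_strategy sigma1 /\
           positive_winning1 sigma1 (at_least L r 1) s) /\
        (forall eps : R, 0 < eps -> exists sigma1 : strategy G One,
           markov_strategy sigma1 /\
           positive_winning1 sigma1 (at_least L r (1 - eps)) s),
      (* the time-dependent memory of Markov strategies *)
      forall (G : game R) (s : state G) (sigma1 : strategy G One),
        markov_strategy sigma1 ->
        exists next : state G -> nat -> fdist R (action G),
          represents (clock_rep next) sigma1 /\
          forall T : nat, (0 < T)%N -> Theta (clock_rep next) T = T &
      (* the lower bound on the time-dependent memory *)
      exists (G : game R) (r : reward G) (s : state G),
        forall (L : limavg) (eps : R), 0 <= eps < 1 ->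
          Positive1 (at_least L r (1 - eps)) s /\
          forall sigma1 : strategy G One,
            positive_winning1 sigma1 (at_least L r (1 - eps)) s ->
            forall (Mem : Type) (M : memory_rep G Mem), represents M sigma1 ->
            forall T : nat, (0 < T)%N -> (T <= Theta M T)%N]
  /\
  (* Player 2 *)
  [/\ (* stationary strategies of patience at most m suffice *)
      forall (G : game R) (r : reward G) (s : state G) (L : limavg),
        ((exists sigma2 : strategy G Two,
            almost_sure_winning2 sigma2 (less_than L r 1) s) ->
         exists sigma2 : strategy G Two,
           [/\ stationary_strategy sigma2,
               almost_sure_winning2 sigma2 (less_than L r 1) s &
               patience sigma2 <= (max_actions G)%:R]) /\
        ((exists c : R, 0 < c /\ exists sigma2 : strategy G Two,
            almost_sure_winning2 sigma2 (less_than L r (1 - c)) s) ->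
         exists c : R, 0 < c /\ exists sigma2 : strategy G Two,
           [/\ stationary_strategy sigma2,
               almost_sure_winning2 sigma2 (less_than L r (1 - c)) s &
               patience sigma2 <= (max_actions G)%:R]) &
      (* the lower bound on the patience *)
      forall m : nat, (1 <= m)%N ->
      exists (G : game R) (r : reward G) (s : state G),
        (forall (i : player) (t : state G), #|avail i t| = m) /\
        forall L : limavg,
          [/\ exists sigma2 : strategy G Two,
                almost_sure_winning2 sigma2 (less_than L r 1) s,
              exists c : R, 0 < c /\ exists sigma2 : strategy G Two,
                almost_sure_winning2 sigma2 (less_than L r (1 - c)) s &
              forall sigma2 : strategy G Two, stationary_strategy sigma2 ->
                (almost_sure_winning2 sigma2 (less_than L r 1) s \/
                 exists c : R, 0 < c /\
                   almost_sure_winning2 sigma2 (less_than L r (1 - c)) s) ->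
                m%:R <= patience sigma2]].
Proof.
split; split.
- exists (gamble R), (@gamble_reward R), None; split.
    exact: gamble_positive.
  move=> eps /andP[eps0 eps1] sigma1 [Mem [M M_sigma1]] L win.
  have l0 : 0 < 1 - eps by rewrite subr_gt0.
  (* Pigeonhole: one more cautious history than there are memory states. *)
  pose f (i : 'I_#|Mem|.+1) := memory_after M (cautious sigma1 i).
  have f_inj : injective f.
    move=> i j fij; apply/val_inj => /=.
    have [lt_ij|lt_ji|//] := ltngtP i j; exfalso.
      by case: (no_collision M_sigma1 l0 win lt_ij).
    by case: (no_collision M_sigma1 l0 win lt_ji).
  by have := leq_card f f_inj; rewrite card_ord ltnn.
- move=> G r s L win.
  have [Y [c [sigma1 [sigma2 [c0 markov _ win1 win2]]]]] := limavg_determinacy r.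
  have sY : s \notin Y.
    (* In [Y] player 2 wins for [1 - c], which excludes the first hypothesis and the second one at
       [eps = c]. *)
    apply/negP => sY; case: win => [[sigma1' win]|/(_ c c0)[sigma1' win]].
      by apply: (winning_exclusive _ win) (win2 L s sY); rewrite gerBl ltW.
    exact: winning_exclusive (lexx _) win (win2 L s sY).
  split; first by exists sigma1; split => //; exact: win1.
  move=> eps eps0; exists sigma1; split => //.
  by apply: positive_winning1_le (win1 L s sY); rewrite gerBl ltW.
- move=> G s sigma1 markov; have [next H] := markov_clock s markov.
  by exists next; split => // T _; exact: Theta_clock s next T.
- exists (gamble R), (@gamble_reward R), None => L eps /andP[eps0 eps1].
  have l0 : 0 < 1 - eps by rewrite subr_gt0.
  split.
    have [sigma1 win] := gamble_positive R; exists sigma1.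
    apply: positive_winning1_LimInf; apply: positive_winning1_le win.
    by rewrite gerBl.
  move=> sigma1 win Mem M M_sigma1 T _.
  apply: (leq_Theta (f := cautious sigma1)) => [n|i j /andP[ij _]].
    exact: size_cautious.
  exact: (no_collision M_sigma1 l0 win ij).
- move=> G r s L.
  have [Y [c [sigma1 [sigma2 [c0 _ [stat pat] win1 win2]]]]] := limavg_determinacy r.
  split=> [[sigma2' win]|[c' [c'0 [sigma2' win]]]].
    have sY : s \in Y.
      apply: contrapT => /negP sY.
      exact: winning_exclusive (lexx _) (win1 L s sY) win.
    exists sigma2; split=> //; last exact: pat.
    by apply: almost_sure_winning2_le (win2 L s sY); rewrite gerBl ltW.
  (* The constant is the one from determinacy, not the given [c']. *)
  exists c; split=> //; exists sigma2; split=> //; [apply: win2|exact: pat].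
  apply: contrapT => /negP sY.
  by apply: (winning_exclusive _ (win1 L s sY) win); rewrite gerBl ltW.
- case=> [//|m'] _; exists (mismatch R m'), (@mismatch_reward R m'), tt.
  split; first exact: mismatch_card_avail.
  have [c c0 [sigma2 win]] := mismatch_winning R m'.
  move=> L; split.
  + exists sigma2; apply: almost_sure_winning2_le (win L).
    by rewrite gerBl ltW.
  + by exists c; split => //; exists sigma2.
  + move=> sigma2' stat [win'|[c' [c'0 win']]].
      exact: mismatch_patience stat win'.
    apply: mismatch_patience stat _.
    by apply: almost_sure_winning2_le win'; rewrite gerBl ltW.
Qed.
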